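(* Fix physical parameters $\rho_l>0$, $\kappa\ge 0$, $\sigma>0$, $T_\infty>0$, $p_{\infty,*}>0$, $R_g>0$, $c_v>0$, and set $\gamma=1+R_g/c_v$. Let $M>0$. Then there exists a solution $(\Omega_*,\mathbf v_{l,*},p_{l,*},\rho_{g,*},\mathbf v_{g,*},p_{g,*})$ of the steady-state system below, satisfying the far-field conditions and the mass constraint $\int_{\Omega_*}\rho_{g,*}\,dx=M$, such that $\mathbf v_{l,*}\not\equiv\mathbf 0$ and $\Omega_*=B_{R_*}$ is a ball of some radius $R_*=R_*[M]>0$ (depending on $M$). The steady-state system: the unknowns are a bounded open region $\Omega_*\subset\mathbb R^3$ (the bubble), a liquid velocity $\mathbf v_{l,*}$ and liquid pressure $p_{l,*}$ on $\mathbb R^3\setminus\Omega_*$, a gas density $\rho_{g,*}>0$ and gas velocity $\mathbf v_{g,*}$ on $\Omega_*$, and a constant gas pressure $p_{g,*}$, satisfying \begin{itemize} \item in $\mathbb R^3\setminus\Omega_*$: $\ (\mathbf v_{l,*}\cdot\nabla)\mathbf v_{l,*}=-\frac{1}{\rho_l}\nabla p_{l,*}$ and $\nabla\cdot\mathbf v_{l,*}=0$; \item in $\Omega_*$: $\ \nabla\cdot(\rho_{g,*}\mathbf v_{g,*})=0$, $p_{g,*}$ is constant, and $0=\frac{\kappa}{\gamma c_v}\Delta\log\rho_{g,*}-\frac{\kappa}{\gamma c_v}\frac{|\nabla\rho_{g,*}|^2}{\rho_{g,*}^2}-\mathbf v_{g,*}\cdot\nabla\rho_{g,*}$; \item on $\partial\Omega_*$: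 $\ \mathbf v_{l,*}\cdot\hat{\mathbf n}=\mathbf v_{g,*}\cdot\hat{\mathbf n}=0$, $\ p_{g,*}-p_{l,*}=\sigma\,\nabla_S\cdot\hat{\mathbf n}$, $\ p_{g,*}=R_gT_\infty\rho_{g,*}$; \end{itemize} with far-field conditions $\mathbf v_{l,*}(x)=O(|x|^{-2})$, $\nabla\mathbf v_{l,*}(x)\to 0$ and $p_{l,*}(x)\to p_{\infty,*}$ as $|x|\to\infty$.
   Context: $\hat{\mathbf n}$ denotes the unit outward normal to $\Omega_*$ on $\partial\Omega_*$ and $\nabla_S\cdot\hat{\mathbf n}$ its surface divergence, i.e. twice the mean curvature of $\partial\Omega_*$ (so that for a sphere of radius $R$ it equals $2/R$). Physically: $\rho_l$ is the liquid density, $\kappa$ the gas thermal conductivity, $\sigma$ the surface tension, $T_\infty$ the far-field temperature, $p_{\infty,*}$ the far-field pressure, $R_g$ the specific gas constant, $c_v$ the heat capacity at constant volume, and $\gamma$ the adiabatic constant. *)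

(* Defs.v *)
From HB Require Import structures.
From mathcomp Require Import all_boot all_order all_algebra.
From mathcomp Require Import all_classical all_reals all_analysis.
Set Implicit Arguments. Unset Strict Implicit. Unset Printing Implicit Defensive.
Import Order.TTheory GRing.Theory Num.Theory.
Import numFieldNormedType.Exports.
Local Open Scope classical_set_scope.
Local Open Scope ring_scope.

Section Defs.
Variable R : realType.
Notation V := 'rV[R]_3.

(* Euclidean structure of R^3 (the library norm on 'rV is the sup-norm,
   so we use the Euclidean one explicitly). *)
Definition dot3 (u w : V) : R := \sum_(i < 3) u 0 i * w 0 i.
Definition enorm3 (u : V) : R := Num.sqrt (dot3 u u).

Definition ball3 (r : R) : set V := [set x | enorm3 x < r].
Definition sphere3 (r : R) : set V := [set x | enorm3 x = r].
Definition cball3 (r : R) : set V := [set x | enorm3 x <= r].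
Definition ext3 (r : R) : set V := [set x | r < enorm3 x].
Definition cext3 (r : R) : set V := [set x | r <= enorm3 x].

Definition e3 (i : 'I_3) : V := delta_mx 0 i.

Definition dpart (W : normedModType R) (f : V -> W) (i : 'I_3) (x : V) : W :=
  'D_(e3 i) f x.

Definition grad3 (f : V -> R) (x : V) : V := \row_(i < 3) dpart f i x.
Definition div3 (v : V -> V) (x : V) : R := \sum_(i < 3) (dpart v i x) 0 i.
Definition lap3 (f : V -> R) (x : V) : R :=
  \sum_(i < 3) dpart (dpart f i) i x.
Definition advect3 (v : V -> V) (x : V) : V :=
  \row_(j < 3) \sum_(i < 3) v x 0 i * (dpart v i x) 0 j.

Definition normal_sphere (r : R) (x : V) : V := r^-1 *: x.
(* surface divergence of the outward unit normal of the sphere of radius r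
   (twice the mean curvature) *)
Definition surfdiv_normal_sphere (r : R) : R := 2 / r.

(* identification R x R x R ~ R^3, used to integrate with the product
   Lebesgue measure *)
Definition tr3 (p : R * R * R) : V :=
  \row_(i < 3) [:: p.1.1; p.1.2; p.2]`_i.

Definition leb3 :=
  (((@lebesgue_measure R) \x (@lebesgue_measure R)) \x (@lebesgue_measure R))%E.
End Defs.
Arguments dot3 {R}. Arguments enorm3 {R}. Arguments ball3 {R}. Arguments sphere3 {R}.
Arguments cball3 {R}. Arguments ext3 {R}. Arguments cext3 {R}. Arguments e3 {R}.
Arguments dpart {R W}. Arguments grad3 {R}. Arguments div3 {R}. Arguments lap3 {R}.
Arguments advect3 {R}. Arguments normal_sphere {R}. Arguments surfdiv_normal_sphere {R}.
Arguments tr3 {R}. Arguments leb3 R : clear implicits.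

(* Main.v *)
Require Import Defs.
From HB Require Import structures.
From mathcomp Require Import all_boot all_order all_algebra.
From mathcomp Require Import all_classical all_reals all_analysis.
From mathcomp Require Import measurable_realfun ring lra.
Import Order.TTheory GRing.Theory Num.Theory.
Import numFieldNormedType.Exports.
Local Open Scope classical_set_scope.
Local Open Scope ring_scope.

(** The gas is at rest with constant density, so the gas equations are trivial
    and only the Laplace pressure jump and the mass constraint remain.  The
    liquid carries a nonzero steady Euler flow with compact support, of the
    kind discovered by Gavrilov, placed in a solid torus above the bubble; near
    the bubble the liquid is at rest with pressure p_inf, and the radius solves
    (p_inf + 2 sigma / R) vol(B_R) = R_g T_inf M by the intermediate value
    theorem.

    If v solves the steady Euler equations with pressure p and v . grad p = 0,
    then so does phi(p) v with pressure Phi(p), Phi' = phi^2; hence it is enough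
    to find such a v near a circle around which the levels of p are nested tori,
    and to cut it off.  Take v axisymmetric with swirl and stream function p.
    In the variables w = s^2 (s the distance to the axis) and z, the equations
    together with |v|^2 = 3p force dp/dw to be affine in w on each level of p,
    dp/dw = w/4 + y(p), and make (dp/dz)^2 an explicit function of w and p.  The
    compatibility of the two first-order equations is a second-order ordinary
    differential equation for y, singular at p = 0, whose regular solution is
    obtained by a contraction.  With h = w - 3/4 one first solves along h = 0,
    where p = r(z)^2, and then along h; the identity for (dp/dz)^2 propagates
    because both sides satisfy the same linear equation in h. *)

(** * Functions of one real variable *)

Section one_variable.
Context {R : realType}.
Implicit Types (f g F : R -> R) (l : R).

(** Banach iteration for the uniform distance: a bound [d] valid at all points stands for the
    distance, so no metric on functions has to be built. The limit is taken pointwise by nested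
    intervals, and [S] contains it because it is closed under uniform limits. *)
Lemma contraction_fixpoint {X : Type} (T : (X -> R) -> X -> R)
    (S : set (X -> R)) (u0 : X -> R) (C : R) :
  S u0 -> (forall u, S u -> S (T u)) ->
  (forall u v d, S u -> S v -> (forall x, `|u x - v x| <= d) ->
     forall x, `|T u x - T v x| <= d / 2) ->
  (forall x, `|T u0 x - u0 x| <= C) ->
  (forall u, (forall e, 0 < e -> exists2 v, S v & forall x, `|u x - v x| <= e) ->
     S u) ->
  exists2 u, S u & forall x, T u x = u x.
Proof.
move=> S0 ST Tlip T0 Scl.
pose U n := iter n T u0.
pose r n : R := C / 2 ^+ n.
have SU n : S (U n) by elim: n => //= n; exact: ST.
have rS n : r n.+1 = r n / 2 by rewrite /r exprS; field; rewrite expf_neq0.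
have step n x : `|U n.+1 x - U n x| <= r n.
  elim: n x => [|n IH] x; first by rewrite /r expr0 divr1; exact: T0.
  by rewrite rS; exact: (Tlip _ _ _ (SU n.+1) (SU n) IH).
(* The intervals of radius [2 * r n] around [U n x] are nested, because
   [r n = 2 * r n - 2 * r n.+1]; the limit is the supremum of their left ends. *)
have lo n x m : U n x - 2 * r n <= U (n + m)%N x - 2 * r (n + m)%N.
  elim: m => [|m IH]; first by rewrite addn0.
  apply: (le_trans IH); rewrite addnS rS.
  by have := step (n + m)%N x; rewrite ler_norml => /andP[? ?]; lra.
have hi n x m : U (n + m)%N x + 2 * r (n + m)%N <= U n x + 2 * r n.
  elim: m => [|m IH]; first by rewrite addn0.
  apply: le_trans IH; rewrite addnS rS.
  by have := step (n + m)%N x; rewrite ler_norml => /andP[? ?]; lra.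
have rhalf (x : X) n : 0 <= r n by apply: le_trans (step n x); exact: normr_ge0.
have lohi x n m : U n x - 2 * r n <= U m x + 2 * r m.
  have := lo n x m; have := hi m x n; rewrite addnC => h1 h2.
  by have := rhalf x (n + m)%N; lra.
pose A x := [set U n x - 2 * r n | n in [set: nat]].
pose u x := sup (A x).
have supA x : has_sup (A x).
  split; first by exists (U 0%N x - 2 * r 0%N), 0%N.
  by exists (U 0%N x + 2 * r 0%N) => _ [n _ <-].
have uU n x : `|u x - U n x| <= 2 * r n.
  have h1 : U n x - 2 * r n <= u x by apply: ub_le_sup; [case: (supA x)|exists n].
  have h2 : u x <= U n x + 2 * r n.
    by apply: ge_sup; [case: (supA x)|move=> _ [m _ <-]].
  by rewrite ler_norml; apply/andP; split; lra.
have small e : 0 < e -> exists n, 4 * r n <= e.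
  move=> e0.
  have C0 : 0 <= `|C| by [].
  have [n hn] : exists n : nat, 4 * `|C| / e <= n%:R.
    exists (Num.bound (4 * `|C| / e)).
    by apply/ltW/archi_boundP; rewrite divr_ge0 ?mulr_ge0 // ltW.
  exists n; rewrite /r mulrA ler_pdivrMr ?exprn_gt0 //.
  have n2 : n%:R <= 2 ^+ n :> R by rewrite -natrX ler_nat ltnW // ltn_expl.
  have : 4 * `|C| <= e * 2 ^+ n.
    rewrite ler_pdivrMr // in hn; apply: (le_trans hn); rewrite mulrC.
    by rewrite ler_pM2l.
  apply: le_trans; by rewrite ler_pM2l // ler_norm.
have Su : S u.
  apply: Scl => e e0; have [n hn] := small e e0; exists (U n) => // x.
  by apply: (le_trans (uU n x)); have := rhalf x n; lra.
exists u => // x; apply/eqP; rewrite -subr_eq0 -normr_le0.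
apply/ler_addgt0Pl => e e0; rewrite addr0.
have [n hn] := small e e0.
have h1 : `|T u x - U n.+1 x| <= r n.
  have := Tlip u (U n) (2 * r n) Su (SU n) (uU n) x.
  by move=> /= h; apply: (le_trans h); lra.
have := uU n.+1 x; rewrite rS distrC => h2.
have := ler_distD (U n.+1 x) (T u x) (u x).
move=> /le_trans; apply.
by have := rhalf x n; lra.
Qed.

Lemma is_derive_continuous f (x : R) l : is_derive x (1 : R) f l -> {for x, continuous f}.
Proof. by case=> df _; apply/differentiable_continuous/derivable1_diffP. Qed.

(** The endpoints may come in either order, so that one statement serves arguments on both sides of
    a base point. *)
Lemma mean_value f (df : R -> R) (a b : R) :
  (forall x, (a <= x <= b) || (b <= x <= a) -> is_derive x (1 : R) f (df x)) ->
  exists2 c, (a <= c <= b) || (b <= c <= a) & f b - f a = df c * (b - a).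
Proof.
wlog ab : a b / a <= b => [H|].
  case: (leP a b) => [|/ltW] ab; first exact: H.
  move=> D; have [x hx|c hc e] := H b a ab.
    by apply: D; rewrite orbC.
  by exists c; [rewrite orbC|lra].
move=> D; have [x|| c cab e] := @MVT_segment _ f df a b ab.
- rewrite in_itv /= => /andP[h1 h2]; by apply: D; rewrite (ltW h1) (ltW h2).
- apply: derivable_within_continuous => x; rewrite in_itv /= => h.
  by case: (D x); rewrite ?h.
- by exists c => //; move: cab; rewrite in_itv /= => ->.
Qed.

Lemma between_dist (a b x : R) :
  (a <= x <= b) || (b <= x <= a) -> `|x - a| <= `|b - a|.
Proof.
by case/orP => /andP[h1 h2]; [rewrite !ger0_norm|rewrite !ler0_norm]; lra.
Qed.

Lemma mean_value_bound f (df : R -> R) (a b K : R) :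
  (forall x, (a <= x <= b) || (b <= x <= a) ->
     is_derive x (1 : R) f (df x) /\ `|df x| <= K) ->
  `|f b - f a| <= K * `|b - a|.
Proof.
move=> D; have [x hx|c hc ->] := @mean_value f df a b; first by case: (D x hx).
by rewrite normrM ler_wpM2r //; case: (D c hc).
Qed.

(** Integrals start at [- a] and are normalised to vanish at 0. Two of them have the same derivative
    where both apply, hence agree there, and letting [a] grow with [|x|] gives a primitive on the
    whole line. *)
Lemma primitive_ex f : continuous f ->
  exists F, F 0 = 0 /\ forall x, is_derive x (1 : R) F (f x).
Proof.
move=> cf.
pose mu := @lebesgue_measure R.
pose I a x := (\int[mu]_(t in `[- a, x]) f t)%R.
pose G a x := I a x - I a 0.
have dG (a x : R) : - a < x -> is_derive x (1 : R) (G a) (f x).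
  move=> ax.
  have [||||d e] := @continuous_FTC1_closed R f (- a) x (x + 1).
  - lra.
  - apply: continuous_compact_integrable; first exact: segment_compact.
    by apply: continuous_subspaceT.
  - by [].
  - exact: cf.
  have dI : is_derive x (1 : R) (I a) (f x) by split; [exact: d|rewrite -derive1E; exact: e].
  by have := is_deriveB dI (is_derive_cst (I a 0) x 1); rewrite subr0.
have G0 a : G a 0 = 0 by rewrite /G subrr.
have GG (a b x : R) : 0 < a -> a <= b -> - a < x -> G a x = G b x.
  move=> a0 ab ax.
  have [c|c _] := @mean_value (fun y => G a y - G b y) (fun=> 0) 0 x.
    move=> h; have ac : - a < c by case/orP: h => /andP[? ?]; case: (leP 0 x) => ?; lra.
    have bc : - b < c by lra.
    by have := is_deriveB (dG a c ac) (dG b c bc); rewrite subrr.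
  by rewrite !G0 subrr mul0r subr0 => /subr0_eq.
pose F x := G (`|x| + 1) x.
exists F; split=> [|x]; first by rewrite /F G0.
have D := dG (`|x| + 2) x.
have {}D : is_derive x (1 : R) (G (`|x| + 2)) (f x).
  by apply: D; have := ler_norm (- x); rewrite normrN; lra.
apply: near_eq_is_derive D; near=> y; rewrite /F; apply/esym/GG.
- by rewrite ltr_wpDl.
- have : `|y - x| < 1 by near: y; apply: cvgr_distC_lt => //; exact: cvg_id.
  by have := lerB_dist y x; lra.
- by have := ler_norm (- y); rewrite normrN; lra.
Unshelve. all: by end_near. Qed.

(** * Differentiability by estimates, inverse functions, linear equations *)

Implicit Types (df : R -> R) (x y t a b k : R).

Lemma continuousP_eps f (x : R) : {for x, continuous f} <->
  forall e, 0 < e -> exists2 d, 0 < d & forall y, `|y - x| < d -> `|f y - f x| <= e.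
Proof.
split=> [cf e e0|H].
  have /cvgrPdist_le/(_ e e0) := cf; rewrite near_simpl => /nbhs_ballP[d d0 hd].
  exists d => // y yx; rewrite distrC; apply: hd.
  by rewrite /ball /= distrC.
apply/cvgrPdist_le => e e0; have [d d0 hd] := H e e0.
apply/nbhs_ballP; exists d => // y; rewrite /ball /= distrC => yx.
by rewrite distrC; exact: hd.
Qed.

Lemma is_derive_epsP f (x l : R) : is_derive x 1 f l <->
  forall e, 0 < e -> exists2 d, 0 < d & forall y, `|y - x| < d ->
    `|f y - f x - l * (y - x)| <= e * `|y - x|.
Proof.
split=> [/is_derive1_caratheodory[g [fE cg gx]] e e0|H].
  have [d d0 hd] := (continuousP_eps g x).1 cg e e0.
  exists d => // y yx; rewrite fE -mulrBl normrM ler_wpM2r //.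
  by have := hd y yx; rewrite gx.
apply/is_derive1_caratheodory.
exists (fun y => if y == x then l else (f y - f x) / (y - x)); split.
- move=> z; case: eqP => [->|/eqP zx]; first by rewrite !subrr mulr0.
  by rewrite divfK // subr_eq0.
- apply/continuousP_eps => e e0; have [d d0 hd] := H e e0; exists d => // y yx.
  rewrite eqxx; case: eqP => [_|/eqP nyx]; first by rewrite subrr normr0 ltW.
  have yx0 : y - x != 0 by rewrite subr_eq0.
  have := hd y yx; rewrite -ler_pdivrMr ?normr_gt0 // -normfV -normrM.
  by rewrite mulrBl mulfK.
- by rewrite eqxx.
Qed.

(** The mean value theorem writes the difference quotient at [x] as a value of [df] at a nearby
    point other than [x]. It serves at z = 0, where a square root cannot be differentiated. *)
Lemma is_derive_limit f df (x r : R) : 0 < r ->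
  (forall y, y != x -> `|y - x| < r -> is_derive y 1 f (df y)) ->
  {for x, continuous f} -> {for x, continuous df} -> is_derive x 1 f (df x).
Proof.
move=> r0 D cf cdf; apply/is_derive_epsP => e e0.
have [d d0 hd] := (continuousP_eps df x).1 cdf e e0.
exists (Num.min d r) => [|y]; first by rewrite lt_min d0.
rewrite lt_min => /andP[yd yr].
(* Subtracting the linear part reduces the claim to a mean value estimate for [m], whose derivative
   [df t - df x] is small near [x]. *)
pose m t := f t - df x * t.
have Dm t : t != x -> `|t - x| < r -> is_derive t 1 m (df t - df x).
  move=> tx tr; apply: is_deriveB; first exact: D.
  by have := is_deriveZ (df x) (is_derive_id t (1:R)); rewrite [_ *: 1]mulr1.
have -> : f y - f x - df x * (y - x) = m y - m x by rewrite /m; ring.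
have [yx|xy|->] := ltgtP y x; last by rewrite !subrr normr0 mulr0.
- have [t||t] := @MVT _ m (fun t => df t - df x) y x yx.
  + rewrite in_itv /= => /andP[h1 h2]; apply: Dm; first by rewrite lt_eqF.
    apply: le_lt_trans yr; rewrite !ltr0_norm; lra.
  + apply/continuous_within_itvP => //; split.
    * move=> t; rewrite in_itv /= => /andP[h1 h2].
      apply: is_derive_continuous; apply: Dm; first by rewrite lt_eqF.
      by apply: le_lt_trans yr; rewrite !ltr0_norm; lra.
    * apply: cvg_at_right_filter; apply: is_derive_continuous.
      by apply: Dm => //; rewrite lt_eqF.
    * apply: cvg_at_left_filter; apply: continuousB; first exact: cf.
      by apply: continuousM; [exact: cst_continuous|exact: cvg_id].
  rewrite in_itv /= => /andP[h1 h2] h; rewrite distrC h normrM (distrC y).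
  rewrite ler_wpM2r // hd //.
  by apply: le_lt_trans yd; rewrite !ltr0_norm; lra.
- have [t||t] := @MVT _ m (fun t => df t - df x) x y xy.
  + rewrite in_itv /= => /andP[h1 h2]; apply: Dm; first by rewrite gt_eqF.
    apply: le_lt_trans yr; rewrite !gtr0_norm; lra.
  + apply/continuous_within_itvP => //; split.
    * move=> t; rewrite in_itv /= => /andP[h1 h2].
      apply: is_derive_continuous; apply: Dm; first by rewrite gt_eqF.
      by apply: le_lt_trans yr; rewrite !gtr0_norm; lra.
    * apply: cvg_at_right_filter; apply: continuousB; first exact: cf.
      by apply: continuousM; [exact: cst_continuous|exact: cvg_id].
    * apply: cvg_at_left_filter; apply: is_derive_continuous.
      by apply: Dm => //; rewrite gt_eqF.
  rewrite in_itv /= => /andP[h1 h2] h; rewrite h normrM.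
  rewrite ler_wpM2r // hd //.
  by apply: le_lt_trans yd; rewrite !gtr0_norm; lra.
Qed.

(** Growth at rate at least [c] makes [f] injective and makes it take the value [y] within distance
    [|y - f 0| / c] of 0. *)
Lemma inverse_ex f df (c : R) : 0 < c -> (forall x, c <= df x) ->
  (forall x, is_derive x 1 f (df x)) ->
  exists g, [/\ cancel f g, cancel g f & forall y, is_derive y 1 g (df (g y))^-1].
Proof.
move=> c0 cdf D.
have inc x y : x <= y -> c * (y - x) <= f y - f x.
  move=> xy; have [t _ ->] := mean_value f df x y (fun t _ => D t).
  by rewrite ler_wpM2r // subr_ge0.
have cf : continuous f by move=> x; exact: is_derive_continuous (D x).
have sur y : exists x, f x = y.
  pose b := `|y - f 0| / c.
  have b0 : 0 <= b by rewrite divr_ge0 // ltW.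
  have cb : c * b = `|y - f 0| by rewrite /b mulrC divfK // gt_eqF.
  have h1 := inc 0 b b0; have h2 := inc (- b) 0.
  have {}h2 : c * b <= f 0 - f (- b) by rewrite -[X in c * X]opprK -[- - b]add0r h2 // oppr_le0.
  rewrite subr0 in h1.
  have [|||x _ fx] := @IVT R f (- b) b y; first by lra.
  - exact: continuous_subspaceT.
  - rewrite ge_min le_max; rewrite cb in h1 h2.
    have := ler_norm (y - f 0); have := ler_norm (- (y - f 0)); rewrite normrN => ? ?.
    by apply/andP; split; apply/orP; [left|right]; lra.
  by exists x.
have [g gK] := choice sur.
have fK : cancel f g.
  move=> x; have := gK (f x); move: (g _) => t ft.
  have [h|h] := leP x t.
    have := inc x t h; rewrite ft subrr pmulr_rle0 // subr_le0 => h'.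
    by apply/eqP; rewrite eq_le h h'.
  have := inc t x (ltW h); rewrite ft subrr pmulr_rle0 // subr_le0 => h'.
  by apply/eqP; rewrite eq_le h' (ltW h).
exists g; split=> // y.
rewrite -{1}(gK y); apply: is_derive_inverse => //.
- by exists 1 => //= z _; exact: fK.
- by exists 1 => //= z _; exact: cf.
- by rewrite gt_eqF // (lt_le_trans c0).
Qed.

(** Calculus rules with explicit [fun t => ...] and products in place of scalings, so that composed
    derivatives are expressions fit for [ring] and [field]. *)
Lemma is_derive_add f g x a b : is_derive x 1 f a -> is_derive x 1 g b ->
  is_derive x 1 (fun t => f t + g t) (a + b).
Proof. exact: is_deriveD. Qed.

Lemma is_derive_sub f g x a b : is_derive x 1 f a -> is_derive x 1 g b ->
  is_derive x 1 (fun t => f t - g t) (a - b).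
Proof. exact: is_deriveB. Qed.

Lemma is_derive_mul f g x a b : is_derive x 1 f a -> is_derive x 1 g b ->
  is_derive x 1 (fun t => f t * g t) (a * g x + f x * b).
Proof.
move=> df dg; apply: (is_derive_eq (is_deriveM df dg)).
by rewrite /GRing.scale /=; ring.
Qed.

Lemma is_derive_scal k f x a : is_derive x 1 f a ->
  is_derive x 1 (fun t => k * f t) (k * a).
Proof. exact: is_deriveZ. Qed.

Lemma is_derive_chain f g x a b : is_derive (g x) 1 f a -> is_derive x 1 g b ->
  is_derive x 1 (fun t => f (g t)) (a * b).
Proof. exact: is_derive1_comp. Qed.

Lemma is_derive_const k x : is_derive x 1 (fun=> k) 0.
Proof. exact: is_derive_cst. Qed.

Lemma is_derive_ident x : is_derive x 1 (fun t => t) 1.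
Proof. exact: is_derive_id. Qed.

Lemma is_derive_sqr f x l : is_derive x 1 f l ->
  is_derive x 1 (fun t => f t ^+ 2) (2 * f x * l).
Proof.
move=> D; have DM : is_derive x 1 (fun t => f t * f t) (2 * f x * l).
  by apply: (is_derive_eq (is_deriveM D D)); rewrite /GRing.scale /=; ring.
exact: DM.
Qed.

(** The product of [u] and [expR (- K)] has zero derivative. *)
Lemma linear_ode (u v K : R -> R) (a x : R) : K 0 = 0 -> - a < x -> x < a ->
  (forall t, - a < t -> t < a -> is_derive t 1 K (v t)) ->
  (forall t, - a < t -> t < a -> is_derive t 1 u (v t * u t)) ->
  u x = u 0 * expR (K x).
Proof.
move=> K0 xa ax DK Du.
pose m t := u t * expR (- K t).
have [t ht|t _] := mean_value m (fun=> 0) 0 x.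
  have [t1 t2] : - a < t /\ t < a by split; case/orP: ht => /andP[? ?]; lra.
  have DE : is_derive t 1 (fun s => expR (- K s)) (expR (- K t) * - v t).
    exact: (is_derive1_comp (is_derive_expR _) (is_deriveN (DK t t1 t2))).
  apply: (is_derive_eq (is_deriveM (Du t t1 t2) DE)).
  by rewrite /GRing.scale /=; ring.
rewrite mul0r /m K0 oppr0 expR0 mulr1 => /eqP; rewrite subr_eq0 => /eqP <-.
by rewrite -mulrA -expRD addNr expR0 mulr1.
Qed.

End one_variable.

(** * The profile y(p) *)

Section profile.
Context {R : realType}.
Implicit Types (f g F df : R -> R) (x y t s p c l : R).

(** A primitive vanishing at 0, picked by choice; the zero function is the default value when there
    is none, and [primP] covers every continuous [f]. *)
Definition prim f : R -> R :=
  xget (fun=> 0) [set F | F 0 = 0 /\ forall x, is_derive x 1 F (f x)].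

Lemma primP f : continuous f ->
  prim f 0 = 0 /\ forall x, is_derive x 1 (prim f) (f x).
Proof.
move=> /primitive_ex [F HF].
exact: (@xgetPex _ (fun=> 0)
  [set F | F 0 = 0 /\ forall x, is_derive x (1 : R) F (f x)] (ex_intro _ F HF)).
Qed.

Lemma lipschitz_continuous f l : 0 < l ->
  (forall x y, `|f x - f y| <= l * `|x - y|) -> continuous f.
Proof.
move=> l0 H x; apply/continuousP_eps => e e0; exists (e / l); first exact: divr_gt0.
move=> y; rewrite ltr_pdivlMr // mulrC => /ltW yx.
exact: le_trans (H y x) yx.
Qed.

(* Clipping the argument turns the integral operators below into contractions of
   spaces of functions on the whole line. *)
Definition clip (lo hi x : R) : R := Num.max lo (Num.min x hi).

Lemma clip_itv (lo hi x : R) : lo <= hi -> lo <= clip lo hi x <= hi.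
Proof.
by move=> lh; rewrite /clip le_max lexx /= ge_max lh ge_min lexx orbT.
Qed.

Lemma clip_id (lo hi x : R) : lo <= x -> x <= hi -> clip lo hi x = x.
Proof. by move=> x0 xl; rewrite /clip (min_idPl _) // (max_idPr _). Qed.

Lemma clip_lipschitz (lo hi x y : R) : `|clip lo hi x - clip lo hi y| <= `|x - y|.
Proof.
have := ler_norm (x - y); have := ler_norm (- (x - y)); rewrite normrN.
move: `|x - y| => n; rewrite /clip ler_norml.
case: (leP x hi) => ?; case: (leP y hi) => ?; case: (leP lo x) => ?;
  case: (leP lo y) => ?; case: (leP lo hi) => ? ? ?; apply/andP; split; lra.
Qed.

Lemma clip_continuous (lo hi : R) : continuous (clip lo hi).
Proof.
apply: (lipschitz_continuous _ 1) => // x y; rewrite mul1r.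
exact: clip_lipschitz.
Qed.

Lemma inv_lipschitz (a b : R) : 3/4 <= a -> 3/4 <= b ->
  `|a^-1 - b^-1| <= 16/9 * `|a - b|.
Proof.
move=> ha hb.
have -> : a^-1 - b^-1 = (b - a) / (a * b) by field; apply/andP; split; lra.
have ab : 0 < a * b by rewrite mulr_gt0 //; lra.
rewrite normrM distrC normfV (gtr0_norm ab) mulrC ler_wpM2r //.
rewrite -[X in _ <= X]invrK lef_pV2 ?posrE //; first by rewrite invf_div; nra.
Qed.

Lemma inv_itv (a b x : R) : 0 < a -> a <= x <= b -> b^-1 <= x^-1 <= a^-1.
Proof.
move=> a0 /andP[ax xb]; rewrite !lef_pV2 ?posrE ?ax ?xb //; lra.
Qed.

(** The profile is built for pressures in [0, delta]; this length makes the fixed-point map below a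
    contraction. *)
Let delta : R := 200^-1.

(** Candidates for g = dy/dp, a class kept by [profile_map] and closed under uniform limits. The
    Lipschitz bound later controls the second-order error when solutions are differentiated in their
    initial value. *)
Definition admissible : set (R -> R) :=
  [set g | (forall x y, `|g x - g y| <= 120 * `|x - y|) /\
           forall x, 1/2 <= g x <= 2].

(** * Bounds on the moments of g *)

Section moments.
Variable g : R -> R.
Hypothesis Sg : admissible g.

Let cg : continuous g.
Proof. by case: Sg => h _; apply: lipschitz_continuous h. Qed.

Let cg1 : continuous (fun s => s * g s).
Proof. by move=> x; apply: continuousM; [exact: cvg_id|exact: cg]. Qed.

Let I := prim g.
Let J := prim (fun s => s * g s).

Lemma moment0_bounds s t : s <= t -> (t - s) / 2 <= I t - I s <= 2 * (t - s).
Proof.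
move=> st; have [_ DI] := primP _ cg.
have [x _ ->] := mean_value _ _ s t (fun x _ => DI x).
have /andP[h1 h2] := Sg.2 x; apply/andP; split; nra.
Qed.

Lemma moment1_bounds s t : 0 <= s -> s <= t -> 0 <= J t - J s <= 2 * t * (t - s).
Proof.
move=> s0 st; have [_ DI] := primP _ cg1.
have [x hx ->] := mean_value _ _ s t (fun x _ => DI x).
have [h3 h4] : 0 <= x /\ x <= t by case/orP: hx => /andP[? ?]; split; lra.
have /andP[h1 h2] := Sg.2 x.
have h5 : 0 <= x * g x <= t * 2 by apply/andP; split; nra.
by case/andP: h5 => h5 h6; apply/andP; split; nra.
Qed.

Lemma moment1_mean_bounds t : 0 <= t -> 0 <= J t / t <= 2 * t.
Proof.
move=> t0; have [J0 _] := primP _ cg1.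
have := moment1_bounds 0 t (lexx _) t0; rewrite -/J {}[J 0]J0 !subr0 => /andP[h1 h2].
rewrite divr_ge0 //=; have [->|tn0] := eqVneq t 0; first by rewrite invr0 !mulr0.
by rewrite ler_pdivrMr // lt_def tn0.
Qed.

(** At t = 0 the quotient is 0 because the inverse of 0 is 0, and this is also its limit; hence the
    separate case s = 0. *)
Lemma moment1_mean_lipschitz s t : 0 <= s -> s <= t ->
  `|J t / t - J s / s| <= 4 * (t - s).
Proof.
move=> s0 st; have [->|sn0] := eqVneq s 0.
  rewrite invr0 mulr0 !subr0.
  have /andP[h1 h2] := moment1_mean_bounds t (le_trans s0 st).
  by rewrite ger0_norm //; have := le_trans s0 st; lra.
have sp : 0 < s by rewrite lt_def sn0.
have tp : 0 < t by exact: lt_le_trans st.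
have -> : J t / t - J s / s = (J t - J s) / t - (J s / s) * ((t - s) / t).
  by field; rewrite !gt_eqF.
have /andP[h1 h2] := moment1_bounds s t s0 st.
have /andP[h3 h4] := moment1_mean_bounds s s0.
have h5 : 0 <= (J t - J s) / t <= 2 * (t - s).
  rewrite divr_ge0 ?(ltW tp) //= ler_pdivrMr //; lra.
have h6 : 0 <= J s / s * ((t - s) / t) <= 2 * (t - s).
  have h7 : 0 <= (t - s) / t by rewrite divr_ge0 // ?(ltW tp) // subr_ge0.
  have h8 : t * ((t - s) / t) = t - s by field; rewrite gt_eqF.
  by apply/andP; split; nra.
case/andP: h5 => ? ?; case/andP: h6 => ? ?.
by rewrite ler_norml; apply/andP; split; lra.
Qed.

(* With k = dp/dy, [y = d - 3/16] and g = 1/k = dy/dp, the compatibility equation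
   is p k k' + k^2 = 8 p + k - (16/3) d k.  [recip] is the integrated form of its
   solution for k, which is regular at the singular point p = 0. *)
Definition recip t : R := 1 - 16/3 * I t + 40/3 * (J t / t).

Lemma recip_bounds t : 0 <= t -> t <= delta -> 3/4 <= recip t <= 5/4.
Proof.
move=> t0 td; have I0 : I 0 = 0 by case: (primP _ cg).
have := moment0_bounds 0 t t0; rewrite I0 !subr0 => /andP[h1 h2].
have /andP[h3 h4] := moment1_mean_bounds t t0.
by rewrite /recip; move: td; rewrite /delta => td; apply/andP; split; lra.
Qed.

Lemma recip_lipschitz s t : 0 <= s -> s <= t ->
  `|recip t - recip s| <= 64 * (t - s).
Proof.
move=> s0 st; rewrite /recip.
have := moment1_mean_lipschitz s t s0 st; have /andP[h1 h2] := moment0_bounds s t st.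
rewrite !ler_norml => /andP[h3 h4].
by apply/andP; split; lra.
Qed.

End moments.

(** A fixed point satisfies [g = 1 / recip g] on [0, delta], the integrated profile equation, and is
    constant on either side. *)
Definition profile_map g x : R := (recip g (clip 0 delta x))^-1.

Lemma recip_contraction (g h : R -> R) (e t : R) : admissible g -> admissible h ->
  (forall x, `|g x - h x| <= e) -> 0 <= t ->
  `|recip g t - recip h t| <= 20 * t * e.
Proof.
move=> Sg Sh gh t0.
have cg : continuous g by case: Sg => hg _; apply: lipschitz_continuous hg.
have ch : continuous h by case: Sh => hg _; apply: lipschitz_continuous hg.
have cg1 : continuous (fun s => s * g s).
  by move=> x; apply: continuousM; [exact: cvg_id|exact: cg].
have ch1 : continuous (fun s => s * h s).
  by move=> x; apply: continuousM; [exact: cvg_id|exact: ch].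
have e0 : 0 <= e by exact: le_trans (gh 0).
have [Ig DIg] := primP _ cg; have [Ih DIh] := primP _ ch.
have [Jg DJg] := primP _ cg1; have [Jh DJh] := primP _ ch1.
have h1 : `|prim g t - prim h t| <= e * t.
  have := mean_value_bound (prim g \- prim h) (g \- h) 0 t e.
  rewrite /= Ig Ih !subr0 (ger0_norm t0); apply=> x _; split; last exact: gh.
  exact: is_deriveB (DIg x) (DIh x).
have h2 : `|prim (fun s => s * g s) t - prim (fun s => s * h s) t| <= e * t * t.
  have := mean_value_bound (prim (fun s => s * g s) \- prim (fun s => s * h s))
    ((fun s => s * g s) \- (fun s => s * h s)) 0 t (e * t).
  rewrite /= Jg Jh !subr0 (ger0_norm t0); apply=> x hx; split.
    exact: is_deriveB (DJg x) (DJh x).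
  have [x0 xt] : 0 <= x /\ x <= t by case/orP: hx => /andP[? ?]; split; lra.
  by rewrite -mulrBr normrM (ger0_norm x0) mulrC ler_pM.
have h3 : `|prim (fun s => s * g s) t / t - prim (fun s => s * h s) t / t| <= e * t.
  rewrite -mulrBl normrM normfV (ger0_norm t0).
  have [->|tn0] := eqVneq t 0; first by rewrite invr0 !mulr0.
  by rewrite ler_pdivrMr // lt_def tn0.
rewrite /recip; move: h1 h3; rewrite !ler_norml => /andP[? ?] /andP[? ?].
have := mulr_ge0 e0 t0 => ?.
by apply/andP; split; lra.
Qed.

Lemma profile_map_admissible g : admissible g -> admissible (profile_map g).
Proof.
move=> Sg; have d0 : 0 <= delta by rewrite invr_ge0 ler0n.
have B x : 3/4 <= recip g (clip 0 delta x) <= 5/4.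
  by have /andP[h1 h2] := clip_itv 0 delta x d0; exact: recip_bounds.
split=> [x y|x]; last first.
  have /andP[h1 h2] := inv_itv (3/4) (5/4) _ ltac:(lra) (B x).
  by rewrite /profile_map; apply/andP; split; lra.
have /andP[hx _] := B x; have /andP[hy _] := B y.
apply: (le_trans (inv_lipschitz _ _ hx hy)).
(* Inversion costs the factor 16/9, and 16/9 * 64 is below the constant 120 of [admissible]. *)
suff : `|recip g (clip 0 delta x) - recip g (clip 0 delta y)| <= 64 * `|x - y|.
  by have := normr_ge0 (x - y); lra.
have := clip_lipschitz 0 delta x y.
have /andP[hx0 _] := clip_itv 0 delta x d0; have /andP[hy0 _] := clip_itv 0 delta y d0.
have [h|/ltW h] := leP (clip 0 delta x) (clip 0 delta y).
  have := recip_lipschitz g Sg _ _ hx0 h.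
  by have := ler_norm (clip 0 delta y - clip 0 delta x); rewrite distrC => h1; rewrite distrC; lra.
have := recip_lipschitz g Sg _ _ hy0 h.
by have := ler_norm (clip 0 delta x - clip 0 delta y); lra.
Qed.

Lemma admissible_closed u :
  (forall e, 0 < e -> exists2 v, admissible v & forall x, `|u x - v x| <= e) ->
  admissible u.
Proof.
move=> H; split=> [x y|x].
  apply/ler_addgt0Pl => e e0; have [v [Lv _] uv] := H (e / 2) (divr_gt0 e0 (ltr0Sn _ _)).
  have := Lv x y; have := uv x; have := uv y.
  by rewrite !ler_norml => /andP[? ?] /andP[? ?] /andP[? ?]; apply/andP; split; lra.
by apply/andP; split; apply/ler_addgt0Pl => e e0; have [v [_ Bv] uv] := H e e0;
  have /andP[? ?] := Bv x; have := uv x; rewrite ler_norml => /andP[? ?]; lra.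
Qed.

(** Here [g] is the fixed point and [d] its primitive. Differentiating [recip] gives the equation
    for 1/g, and the bounds 4/5 and 4/3 are the inverses of those on [recip]. *)
Lemma profile_ex : exists g d : R -> R,
  [/\ forall x y, `|g x - g y| <= 120 * `|x - y|,
      forall x, 4/5 <= g x <= 4/3,
      d 0 = 0,
      forall x, is_derive x 1 d (g x) &
      forall p, 0 < p -> p < 200^-1 ->
        is_derive p 1 (fun s => (g s)^-1)
          ((8 * p * g p - (g p)^-1 + 1 - 16/3 * d p) / p)].
Proof.
have d0 : 0 <= delta by rewrite invr_ge0 ler0n.
have S1 : admissible (fun=> 1).
  by split=> *; [rewrite subrr normr0 mulr_ge0|apply/andP; split; lra].
have [||||g Sg gE] := @contraction_fixpoint R R profile_map admissible (fun=> 1) 1 S1.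
- exact: profile_map_admissible.
(* The contraction factor is 16/9 * 20 * delta, which is below 1/2. *)
- move=> u v e Su Sv uv x.
  have e0 : 0 <= e by exact: le_trans (uv 0).
  have /andP[h1 h2] := clip_itv 0 delta x d0.
  have /andP[hu _] := recip_bounds u Su _ h1 h2.
  have /andP[hv _] := recip_bounds v Sv _ h1 h2.
  apply: (le_trans (inv_lipschitz _ _ hu hv)).
  have := recip_contraction u v e _ Su Sv uv h1.
  have : clip 0 delta x * e <= delta * e by rewrite ler_wpM2r.
  by rewrite /delta; lra.
- move=> x; have [_ /(_ x)/andP[h1 h2]] := profile_map_admissible _ S1.
  by rewrite ler_norml; apply/andP; split; lra.
- exact: admissible_closed.
have cg : continuous g by case: Sg => hg _; apply: lipschitz_continuous hg.
have cg1 : continuous (fun s => s * g s).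
  by move=> x; apply: continuousM; [exact: cvg_id|exact: cg].
have [I0 DI] := primP _ cg; have [J0 DJ] := primP _ cg1.
exists g, (prim g); split => //.
- exact: Sg.1.
- move=> x; rewrite -gE /profile_map.
  have /andP[h1 h2] := clip_itv 0 delta x d0.
  have /andP[h3 h4] := inv_itv (3/4) (5/4) _ ltac:(lra) (recip_bounds g Sg _ h1 h2).
  by apply/andP; split; lra.
move=> p p0 pd.
have kE s : 0 <= s -> s <= delta -> (g s)^-1 = recip g s.
  by move=> s0 sd; rewrite -gE /profile_map invrK clip_id.
have pn0 : p != 0 by rewrite gt_eqF.
have D : is_derive p 1 (recip g)
    (- (16/3 * g p) + 40/3 * (p * g p / p - prim (fun s => s * g s) p / p ^+ 2)).
  have DV : is_derive p 1 (fun s => s^-1) (- p ^- 2 *: 1).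
    exact: is_deriveV.
  have DM := is_deriveM (DJ p) DV.
  have D1 := is_deriveZ (16/3) (DI p); have D2 := is_deriveZ (40/3) DM.
  apply: (is_derive_eq (is_deriveD (is_deriveB (is_derive_cst (1 : R) p 1) D1) D2)).
  by rewrite /GRing.scale /=; field.
have pd' : p < delta by [].
have D' : is_derive p 1 (fun s => (g s)^-1)
    (- (16/3 * g p) + 40/3 * (p * g p / p - prim (fun s => s * g s) p / p ^+ 2)).
  apply: near_eq_is_derive D; near=> s; rewrite kE //.
    by apply/ltW; near: s; exact: lt_nbhsr.
  by apply/ltW; near: s; exact: lt_nbhsl.
apply: (is_derive_eq D').
rewrite (kE p (ltW p0) (ltW pd')) /recip.
by field.
Unshelve. all: by end_near. Qed.

End profile.

(** * Gradients in space *)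

Section gradients.
Context {R : realType}.
Notation V := 'rV[R]_3.
Implicit Types (x y z h : R) (u : V -> R) (p : V).

(** The differential is supplied as a bare function and packed into a linear map here, so that
    explicit formulas can serve as differentials. *)
Lemma is_diff_eps (X : normedModType R) (f : X -> R) (L : X -> R) (x : X) :
  linear L -> continuous L ->
  (forall e, 0 < e -> \forall v \near (0 : X), `|f (v + x) - f x - L v| <= e * `|v|) ->
  is_diff x f L.
Proof.
move=> linL cL H.
pose LM := GRing.isLinear.Build _ _ _ _ _ linL.
pose LL : {linear X -> R} := HB.pack L LM.
have E : f \o shift x = cst (f x) + LL +o_ 0 id.
  apply/eqaddoP => e e0; apply: filterS (H e e0) => v /=.
  by rewrite opprD addrA.
have dE : 'd f x = LL :> (X -> R) by apply: diff_unique.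
apply: DiffDef; last exact: dE.
by apply/diff_locallyP; rewrite dE; split.
Qed.

(** The increment in h is handled by the mean value theorem and the joint continuity of [fh], the
    increment in z by the derivative at fixed h. The z-derivatives of the pressure are obtained
    pointwise, which suits this form. *)
Lemma is_diff_partial (f fh : R -> R -> R) (fz h z r : R) :
  0 < r ->
  (forall h' z', `|h' - h| < r -> `|z' - z| < r -> is_derive h' 1 (f^~ z') (fh h' z')) ->
  (forall e, 0 < e -> exists2 s, 0 < s & forall h' z', `|h' - h| < s ->
    `|z' - z| < s -> `|fh h' z' - fh h z| <= e) ->
  is_derive z 1 (f h) fz ->
  is_diff (h, z) (fun q : R * R => f q.1 q.2) (fun v => fh h z * v.1 + fz * v.2).
Proof.
move=> r0 Dh ch /is_derive_epsP Dz; apply: is_diff_eps.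
- by move=> k [a1 a2] [b1 b2] /=; rewrite /GRing.scale /=; ring.
- move=> q; apply: cvgD; apply: cvgM; try exact: cvg_cst; [exact: cvg_fst|exact: cvg_snd].
- move=> e e0; have e2 : 0 < e / 2 by rewrite divr_gt0.
  have [s1 s10 H1] := ch _ e2; have [s2 s20 H2] := Dz _ e2.
  have s0 : 0 < Num.min (Num.min s1 s2) r by rewrite !lt_min s10 s20.
  exists (ball 0 (Num.min (Num.min s1 s2) r), ball 0 (Num.min (Num.min s1 s2) r)).
    by split; exact: nbhsx_ballx.
  move=> [u v] [/= ur vr]; move: ur vr; rewrite /ball /= !sub0r !normrN.
  rewrite !lt_min => /andP[/andP[us1 us2] ur] /andP[/andP[vs1 vs2] vr].
  have [c hc|c hc E] := mean_value (f^~ (v + z)) (fun h' => fh h' (v + z)) h (u + h).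
    have cu : `|c - h| <= `|u| by have := between_dist _ _ _ hc; rewrite addrK.
    by apply: Dh; [exact: le_lt_trans ur|rewrite addrK].
  have cu : `|c - h| <= `|u| by have := between_dist _ _ _ hc; rewrite addrK.
  have := H1 c (v + z); rewrite addrK => /(_ (le_lt_trans cu us1) vs1) h1.
  have := H2 (v + z); rewrite addrK => /(_ vs2) h2.
  have nu : `|u| <= `|(u, v)| by rewrite prod_normE le_max lexx.
  have nv : `|v| <= `|(u, v)| by rewrite prod_normE le_max lexx orbT.
  have -> : f (u + h) (v + z) - f h z - (fh h z * u + fz * v) =
     (fh c (v + z) - fh h z) * u + (f h (v + z) - f h z - fz * v).
    by move: E; rewrite addrK => E; rewrite mulrBl -E; ring.
  apply: (le_trans (ler_normD _ _)); rewrite normrM.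
  have : `|fh c (v + z) - fh h z| * `|u| <= e / 2 * `|(u, v)| by apply: ler_pM.
  have : e / 2 * `|v| <= e / 2 * `|(u, v)| by rewrite ler_pM2l.
  by lra.
Qed.

Lemma is_diff_near (X : normedModType R) (f f' L : X -> R) (x : X) :
  (\forall y \near x, f y = f' y) -> is_diff x f L -> is_diff x f' L.
Proof.
move=> ff' [df dE]; have e : f x = f' x by exact: nbhs_singleton ff'.
rewrite -dE; apply: is_diff_eps.
- by move=> k u v; rewrite linearP.
- exact: diff_continuous.
- move=> eps eps0; have /eqaddoP/(_ eps eps0) H := diff_locally df.
  have /= ff'0 : \forall v \near (0 : X), f (v + x) = f' (v + x).
    have cs : shift x @ (0 : X) --> x.
      rewrite -[X in _ --> X]add0r; apply: cvgD; [exact: cvg_id|exact: cvg_cst].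
    exact: cs ff'.
  apply: filterS2 ff'0 H => v ev /=; rewrite !fctE /= -ev -e opprD addrA.
  by [].
Qed.

(** * Gradients, divergence and advection in components *)

Definition row3 (a b c : R) : V := \row_(i < 3) [:: a; b; c]`_i.

Lemma row3E0 a b c : row3 a b c 0 0 = a. Proof. by rewrite mxE. Qed.
Lemma row3E1 a b c : row3 a b c 0 1 = b. Proof. by rewrite mxE. Qed.
Lemma row3E2 a b c : row3 a b c 0 2%R = c. Proof. by rewrite mxE. Qed.

Lemma ord3P (j : 'I_3) : [\/ j = 0, j = 1 | j = 2%R].
Proof.
by case: j => [[|[|[|//]]]] Hj; [apply: Or31|apply: Or32|apply: Or33]; apply/val_inj.
Qed.

Lemma sum3E (F : 'I_3 -> R) : \sum_(i < 3) F i = F 0 + F 1 + F 2%R.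
Proof.
rewrite !big_ord_recl big_ord0 addr0 addrA.
by congr (_ + F _ + F _); apply/val_inj.
Qed.

Lemma dot3E (p q : V) : dot3 p q = p 0 0 * q 0 0 + p 0 1 * q 0 1 + p 0 2%R * q 0 2%R.
Proof. exact: sum3E. Qed.

(** The gradient is recorded as three numbers, so that the rules below produce explicit expressions
    and the equations of motion become identities for [field]. *)
Definition grad_at (u : V -> R) (p : V) (a b c : R) :=
  is_diff p u (fun v => a * v 0 0 + b * v 0 1 + c * v 0 2%R).

Lemma grad_at_eq u p a b c a' b' c' : grad_at u p a b c ->
  a = a' -> b = b' -> c = c' -> grad_at u p a' b' c'.
Proof. by move=> D <- <- <-. Qed.

Lemma grad_at_coord p (j : 'I_3) :
  grad_at (fun q => q 0 j) p (j == 0)%:R (j == 1)%:R (j == 2%R)%:R.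
Proof.
have dc : differentiable (fun q : V => q 0 j) p by exact: differentiable_coord.
apply: DiffDef; first exact: dc.
have lc : linear (fun q : V => q 0 j) by move=> k q q'; rewrite !mxE.
pose LM := GRing.isLinear.Build _ _ _ _ _ lc.
pose LL : {linear V -> R} := HB.pack (fun q : V => q 0 j) LM.
have -> : 'd (fun q : V => q 0 j) p = LL :> (V -> R).
  by apply: (@diff_lin _ _ _ LL); exact: coord_continuous.
apply/funext => q /=.
have [->|] := eqVneq j 0; first by rewrite !mul0r mul1r !addr0.
have [->|] := eqVneq j 1; first by rewrite !mul0r mul1r add0r addr0.
have [->|] := eqVneq j 2%R; first by rewrite !mul0r mul1r !add0r.
by case: j {dc lc LM LL} => [[|[|[|]]]].
Qed.

Lemma grad_at_const k p : grad_at (fun=> k) p 0 0 0.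
Proof.
apply: (is_diff_eq (is_diff_cst (k : R) p)).
by apply/funext => v; rewrite /= !mul0r !addr0.
Qed.

Lemma grad_at_add u u' p a b c a' b' c' : grad_at u p a b c -> grad_at u' p a' b' c' ->
  grad_at (fun q => u q + u' q) p (a + a') (b + b') (c + c').
Proof.
move=> D D'; apply: is_diff_eq (is_diffD D D') _.
by apply/funext => v; rewrite /= !fctE; ring.
Qed.

Lemma grad_at_mul u u' p a b c a' b' c' : grad_at u p a b c -> grad_at u' p a' b' c' ->
  grad_at (fun q => u q * u' q) p (a * u' p + u p * a') (b * u' p + u p * b')
    (c * u' p + u p * c').
Proof.
move=> D D'; apply: is_diff_eq (is_diffM D D') _.
by apply/funext => v; rewrite /= !fctE /GRing.scale /=; ring.
Qed.

Lemma grad_at_near u u' p a b c : (\forall q \near p, u q = u' q) ->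
  grad_at u p a b c -> grad_at u' p a b c.
Proof. exact: is_diff_near. Qed.

Lemma grad_at_chain (F : R -> R) u p a b c l : is_derive (u p) 1 F l ->
  grad_at u p a b c -> grad_at (fun q => F (u q)) p (l * a) (l * b) (l * c).
Proof.
move=> /is_derive_epsP DF D.
have DF' : is_diff (u p) F (fun v => l * v).
  apply: is_diff_eps.
  - by move=> k x y /=; rewrite /GRing.scale /=; ring.
  - by move=> x; apply: cvgM; [exact: cvg_cst|exact: cvg_id].
  - move=> e e0; have [r r0 H] := DF e e0; exists r => //= v.
    rewrite /ball_ /= sub0r normrN => vr.
    by have := H (v + u p); rewrite addrK => /(_ vr).
apply: is_diff_eq (is_diff_comp D DF') _.
by apply/funext => v /=; ring.
Qed.

Lemma grad_at_chain2 (F : R * R -> R) (u u' : V -> R) p a b c a' b' c' k l :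
  is_diff (u p, u' p) F (fun v => k * v.1 + l * v.2) ->
  grad_at u p a b c -> grad_at u' p a' b' c' ->
  grad_at (fun q => F (u q, u' q)) p (k * a + l * a') (k * b + l * b') (k * c + l * c').
Proof.
move=> DF D D'; have Dp := is_diff_pair D D'.
apply: is_diff_eq (is_diff_comp Dp DF) _.
by apply/funext => v /=; ring.
Qed.

Lemma grad_at_differentiable u p a b c : grad_at u p a b c -> differentiable u p.
Proof. by case. Qed.

Lemma e3E (i j : 'I_3) : (e3 i : V) 0 j = (i == j)%:R.
Proof. by rewrite /e3 mxE eqxx eq_sym. Qed.

Lemma grad_at_derive u p a b c : grad_at u p a b c ->
  ('D_(e3 0) u p = a) * ('D_(e3 1) u p = b) * ('D_(e3 2%R) u p = c).
Proof.
case=> du dE; have E v : 'D_v u p = a * v 0 0 + b * v 0 1 + c * v 0 2%R.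
  by rewrite deriveE // dE.
by rewrite !E !e3E /= !mulr1 !mulr0 !addr0 !add0r.
Qed.

Lemma grad3E u p a b c : grad_at u p a b c -> grad3 u p = row3 a b c.
Proof.
move=> D; apply/rowP => i; rewrite mxE /dpart.
case: (ord3P i) => ->; rewrite (grad_at_derive _ _ _ _ _ D).
- by rewrite row3E0.
- by rewrite row3E1.
- by rewrite row3E2.
Qed.

Lemma differentiable_row3 (u0 u1 u2 : V -> R) p : differentiable u0 p ->
  differentiable u1 p -> differentiable u2 p ->
  differentiable (fun q => row3 (u0 q) (u1 q) (u2 q)) p.
Proof.
move=> d0 d1 d2.
have -> : (fun q => row3 (u0 q) (u1 q) (u2 q)) =
    (fun q => u0 q *: e3 0) + (fun q => u1 q *: e3 1) + (fun q => u2 q *: e3 2%R).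
  apply/funext => q; apply/rowP => i; rewrite !fctE !mxE.
  by case: i => [[|[|[|//]]]] Hi; rewrite /= ?mulr1 ?mulr0 ?addr0 ?add0r.
by apply: differentiableD; [apply: differentiableD|]; exact: differentiableZl.
Qed.

Lemma dpart_row3 (u0 u1 u2 : V -> R) p i : differentiable u0 p ->
  differentiable u1 p -> differentiable u2 p ->
  dpart (fun q => row3 (u0 q) (u1 q) (u2 q)) i p =
  row3 (dpart u0 i p) (dpart u1 i p) (dpart u2 i p).
Proof.
move=> d0 d1 d2; rewrite /dpart derive_mx; last first.
  by apply: diff_derivable; exact: differentiable_row3.
apply/matrixP => k j; rewrite ord1 !mxE.
by case: j => [[|[|[|//]]]] Hj /=; congr ('D_(e3 i) _ p); apply/funext => q; rewrite mxE.
Qed.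

Lemma div3E (u0 u1 u2 : V -> R) p a0 b0 c0 a1 b1 c1 a2 b2 c2 :
  grad_at u0 p a0 b0 c0 -> grad_at u1 p a1 b1 c1 -> grad_at u2 p a2 b2 c2 ->
  div3 (fun q => row3 (u0 q) (u1 q) (u2 q)) p = a0 + b1 + c2.
Proof.
move=> D0 D1 D2; have d0 := grad_at_differentiable _ _ _ _ _ D0.
have d1 := grad_at_differentiable _ _ _ _ _ D1.
have d2 := grad_at_differentiable _ _ _ _ _ D2.
have [[E0 _] _] := grad_at_derive _ _ _ _ _ D0.
have [[_ E1] _] := grad_at_derive _ _ _ _ _ D1.
have [_ E2] := grad_at_derive _ _ _ _ _ D2.
rewrite /div3 sum3E; congr (_ + _ + _); rewrite dpart_row3 //.
- by rewrite row3E0.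
- by rewrite row3E1.
- by rewrite row3E2.
Qed.

Lemma advect3E (u0 u1 u2 : V -> R) p a0 b0 c0 a1 b1 c1 a2 b2 c2 :
  grad_at u0 p a0 b0 c0 -> grad_at u1 p a1 b1 c1 -> grad_at u2 p a2 b2 c2 ->
  advect3 (fun q => row3 (u0 q) (u1 q) (u2 q)) p =
  row3 (u0 p * a0 + u1 p * b0 + u2 p * c0) (u0 p * a1 + u1 p * b1 + u2 p * c1)
    (u0 p * a2 + u1 p * b2 + u2 p * c2).
Proof.
move=> D0 D1 D2; have d0 := grad_at_differentiable _ _ _ _ _ D0.
have d1 := grad_at_differentiable _ _ _ _ _ D1.
have d2 := grad_at_differentiable _ _ _ _ _ D2.
have [[E00 E01] E02] := grad_at_derive _ _ _ _ _ D0.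
have [[E10 E11] E12] := grad_at_derive _ _ _ _ _ D1.
have [[E20 E21] E22] := grad_at_derive _ _ _ _ _ D2.
set U := fun q => _.
have P0 : dpart U 0 p = row3 a0 a1 a2 by rewrite dpart_row3 // /dpart E00 E10 E20.
have P1 : dpart U 1 p = row3 b0 b1 b2 by rewrite dpart_row3 // /dpart E01 E11 E21.
have P2 : dpart U 2%R p = row3 c0 c1 c2 by rewrite dpart_row3 // /dpart E02 E12 E22.
apply/rowP => j; rewrite mxE sum3E P0 P1 P2 /U row3E0 row3E1 row3E2.
case: (ord3P j) => ->.
- by rewrite !row3E0.
- by rewrite !row3E1.
- by rewrite !row3E2.
Qed.

End gradients.

(** * The local pressure *)

Section flow.
Context {R : realType}.
Implicit Types (x y t s p c l h z eta : R).
Variables g d : R -> R.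
Hypothesis g_lip : forall x y, `|g x - g y| <= 120 * `|x - y|.
Hypothesis g_itv : forall x, 4/5 <= g x <= 4/3.
Hypothesis d0 : d 0 = 0.
Hypothesis Dd : forall x, is_derive x 1 d (g x).

Lemma g_continuous : continuous g.
Proof. by apply: lipschitz_continuous g_lip. Qed.

Lemma d_continuous : continuous d.
Proof. by move=> x; exact: is_derive_continuous (Dd x). Qed.

Lemma d_lipschitz x y : `|d x - d y| <= 4/3 * `|x - y|.
Proof.
apply: (mean_value_bound d g) => t _; split; first exact: Dd.
by have /andP[h1 h2] := g_itv t; rewrite ger0_norm; lra.
Qed.

Lemma d_linear x y : `|d y - d x - g x * (y - x)| <= 120 * (y - x) ^+ 2.
Proof.
have [c hc ->] := mean_value d g x y (fun t _ => Dd t).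
rewrite -mulrBl normrM -[(y - x) ^+ 2]real_normK ?num_real // expr2 mulrA ler_wpM2r //.
apply: le_trans (g_lip c x) _; rewrite ler_wpM2l //.
exact: between_dist hc.
Qed.

Let a : R := 16^-1.

(** The Picard operator of u' = h/4 + d(u), u(0) = eta. With w = h + 3/4 and y = d - 3/16 this is
    the equation dp/dw = w/4 + y(p). *)
Definition flow_map eta (u : R -> R) h : R :=
  eta + clip (- a) a h ^+ 2 / 8 + prim (d \o u) (clip (- a) a h).

(** The bound keeps u close to eta + h^2/8; it yields the two-sided estimates that confine the low
    levels of the pressure to a neighbourhood of the circle. *)
Definition flow_class eta : set (R -> R) :=
  [set u | continuous u /\ forall h,
    `|u h - eta - clip (- a) a h ^+ 2 / 8| <=
    clip (- a) a h ^+ 2 / 16 + 2 * `|clip (- a) a h| * `|eta|].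

Lemma clip_sym_itv h : `|clip (- a) a h| <= a.
Proof. by rewrite ler_norml clip_itv // /a; lra. Qed.

Lemma clip_sym_id h : `|h| <= a -> clip (- a) a h = h.
Proof. by rewrite ler_norml => /andP[? ?]; rewrite clip_id. Qed.

Lemma flow_map_class eta u : flow_class eta u -> flow_class eta (flow_map eta u).
Proof.
move=> [cu Bu].
have cdu : continuous (d \o u).
  by move=> x; apply: continuous_comp; [exact: cu|exact: d_continuous].
have [P0 DP] := primP _ cdu.
split=> [x|h].
  have cc := clip_continuous (- a) a.
  rewrite /flow_map; apply: cvgD; last first.
    apply: continuous_comp; first exact: cc.
    exact: is_derive_continuous (DP _).
  apply: cvgD; first exact: cvg_cst.
  apply: cvgM; last exact: cvg_cst.
  by apply: cvgM; exact: cc.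
set c := clip (- a) a h.
have := mean_value_bound (prim (d \o u)) (d \o u) 0 c
  (4/3 * (9/8 * `|eta| + 3/16 * c ^+ 2)).
rewrite P0 !subr0 /flow_map -/c => H.
have -> : eta + c ^+ 2 / 8 + prim (d \o u) c - eta - c ^+ 2 / 8 = prim (d \o u) c.
  by ring.
have ca : `|c| <= a by exact: clip_sym_itv.
have e0 := normr_ge0 eta; have c0 := normr_ge0 c.
have c2 : c ^+ 2 = `|c| ^+ 2 by rewrite real_normK // num_real.
apply: (le_trans (H _)); last by rewrite c2 /a in ca *; nra.
move=> t ht {H}; split; first exact: DP.
have tc : `|t| <= `|c|.
  by have := between_dist _ _ _ ht; rewrite !subr0.
have := d_lipschitz (u t) 0; rewrite d0 !subr0 /=.
have := Bu t; rewrite /= clip_sym_id ?(le_trans tc) //.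
have t2 : t ^+ 2 = `|t| ^+ 2 by rewrite real_normK // num_real.
have : t ^+ 2 <= c ^+ 2 by rewrite t2 c2 ler_sqr // nnegrE.
have : 2 * `|t| * `|eta| <= 1/8 * `|eta|.
  by rewrite ler_wpM2r //; move: ca; rewrite /a; lra.
have := ler_normD (u t - eta - t ^+ 2 / 8) (eta + t ^+ 2 / 8).
have := ler_normD eta (t ^+ 2 / 8); have : 0 <= t ^+ 2 by exact: sqr_ge0.
move=> t20; rewrite (ger0_norm (_ : 0 <= t ^+ 2 / 8)); last by lra.
have -> : u t - eta - t ^+ 2 / 8 + (eta + t ^+ 2 / 8) = u t by ring.
by lra.
Qed.

Lemma flow_ex eta : exists u : R -> R,
  [/\ continuous u, u 0 = eta,
      forall h, `|h| <= a ->
        `|u h - eta - h ^+ 2 / 8| <= h ^+ 2 / 16 + 2 * `|h| * `|eta| &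
      forall h, `|h| < a -> is_derive h 1 u (h / 4 + d (u h))].
Proof.
pose u0 h := eta + clip (- a) a h ^+ 2 / 8.
have S0 : flow_class eta u0.
  split=> [x|h]; last first.
    rewrite /u0; set c := clip _ _ _; rewrite (_ : _ - _ - _ = 0); last by ring.
    by rewrite normr0; have := sqr_ge0 c; have := mulr_ge0 (normr_ge0 c) (normr_ge0 eta); lra.
  have cc := clip_continuous (- a) a.
  rewrite /u0; apply: cvgD; first exact: cvg_cst.
  apply: cvgM; last exact: cvg_cst.
  by apply: cvgM; exact: cc.
have cont u : flow_class eta u -> continuous (d \o u).
  by move=> [cu _] x; apply: continuous_comp; [exact: cu|exact: d_continuous].
have [||||u Su uE] :=
  @contraction_fixpoint R R (flow_map eta) (flow_class eta) u0 (1 + `|eta|) S0.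
- exact: flow_map_class.
(* The contraction factor is the Lipschitz constant 4/3 of [d] times the half-width 1/16. *)
- move=> u v e Su Sv uv h.
  have [Pu DPu] := primP _ (cont u Su); have [Pv DPv] := primP _ (cont v Sv).
  rewrite /flow_map; set c := clip _ _ _.
  have := mean_value_bound (prim (d \o u) \- prim (d \o v))
    ((d \o u) \- (d \o v)) 0 c (4/3 * e).
  rewrite /= Pu Pv !subr0 => H.
  rewrite opprD addrACA subrr add0r.
  have e0 : 0 <= e by exact: le_trans (uv 0).
  have ca : `|c| <= a by exact: clip_sym_itv.
  apply: (le_trans (H _)); last by rewrite /a in ca; nra.
  move=> t _; split; first exact: is_deriveB (DPu t) (DPv t).
  apply: (le_trans (d_lipschitz _ _)); rewrite ler_wpM2l //; exact: uv.
- move=> h; have [_ /(_ h)] := flow_map_class _ _ S0; rewrite /u0 /=.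
  set c := clip _ _ _.
  have ca : `|c| <= a by exact: clip_sym_itv.
  rewrite opprD addrA => /le_trans; apply.
  have c2 : c ^+ 2 = `|c| ^+ 2 by rewrite real_normK // num_real.
  have := normr_ge0 eta; have := normr_ge0 c; rewrite c2 /a in ca *; nra.
- move=> u H; split=> [x|h].
    apply/continuousP_eps => e e0.
    have [v [cv _] uv] := H (e / 3) (divr_gt0 e0 (ltr0Sn _ _)).
    have [r r0 hr] := (continuousP_eps v x).1 (cv x) (e / 3) (divr_gt0 e0 (ltr0Sn _ _)).
    exists r => // y yx; have := hr y yx; have := uv y; have := uv x.
    by rewrite !ler_norml => /andP[? ?] /andP[? ?] /andP[? ?]; apply/andP; split; lra.
  apply/ler_addgt0Pl => e e0; have [v [_ /(_ h) Bv] uv] := H e e0.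
  move: Bv; have := uv h.
  by rewrite !ler_norml => /andP[? ?] /andP[? ?]; apply/andP; split; lra.
have [P0 DP] := primP _ (cont u Su).
exists u; split.
- exact: Su.1.
- by rewrite -uE /flow_map clip_sym_id ?normr0 ?P0 ?expr0n /= ?mul0r ?addr0 // /a.
- by move=> h ha; have := Su.2 h; rewrite /= clip_sym_id.
move=> h ha.
have D : is_derive h 1 (fun t => eta + t ^+ 2 / 8 + prim (d \o u) t) (h / 4 + d (u h)).
  have D1 : is_derive h 1 (fun t => 8^-1 * t ^+ 2) (h / 4).
    apply: (is_derive_eq (is_deriveZ 8^-1 (is_derive_sqr _ _ _ (is_derive_id h (1 : R))))).
    by rewrite /GRing.scale /=; field.
  have D2 : is_derive h 1 (fun t => eta + 8^-1 * t ^+ 2 + prim (d \o u) t)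
      (h / 4 + d (u h)).
    apply: (is_derive_eq (is_deriveD (is_deriveD (is_derive_cst eta h 1) D1) (DP h))).
    by rewrite add0r.
  by apply: near_eq_is_derive D2; exists 1 => //= t _; rewrite (mulrC 8^-1).
apply: near_eq_is_derive D; near=> t.
rewrite -[RHS]uE /flow_map clip_sym_id // ltW //.
near: t; have : 0 < a - `|h| by lra.
move=> r0; exists (a - `|h|) => //= t; rewrite /ball /= => th.
by have := lerB_dist t h; rewrite distrC in th; lra.
Unshelve. all: by end_near. Qed.

Definition flow eta : R -> R := sval (cid (flow_ex eta)).

Lemma flow_continuous eta : continuous (flow eta).
Proof. by rewrite /flow; case: cid => u /= []. Qed.

Lemma flow0 eta : flow eta 0 = eta.
Proof. by rewrite /flow; case: cid => u /= []. Qed.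

Lemma flow_bounds eta h : 0 <= eta -> `|h| <= a ->
  7/8 * eta + h ^+ 2 / 16 <= flow eta h <= 9/8 * eta + 3/16 * h ^+ 2.
Proof.
move=> e0 ha.
have : `|flow eta h - eta - h ^+ 2 / 8| <= h ^+ 2 / 16 + 2 * `|h| * `|eta|.
  by rewrite /flow; case: cid => u /= [_ _ + _]; exact.
have : 2 * `|h| * `|eta| <= 1/8 * `|eta|.
  by rewrite ler_wpM2r //; move: ha; rewrite /a; lra.
by rewrite (ger0_norm e0) ler_norml => ? /andP[? ?]; apply/andP; split; lra.
Qed.

Lemma flow_deriv eta h : `|h| < a ->
  is_derive h 1 (flow eta) (h / 4 + d (flow eta h)).
Proof. by rewrite /flow; case: cid => u /= [_ _ _]; exact. Qed.

(** A Gronwall estimate for D^2, whose derivative is at most 3 D^2 in absolute value; squaring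
    avoids a discussion of the sign of D. The inequality exp x >= 1 + x turns the exponential into
    the factor 1 - 3|h|, which exceeds 1/4. *)
Lemma flow_lipschitz eta eta' h : `|h| < a ->
  `|flow eta' h - flow eta h| <= 2 * `|eta' - eta|.
Proof.
move=> ha.
pose D t := flow eta' t - flow eta t.
have DD t : `|t| < a -> is_derive t 1 D (d (flow eta' t) - d (flow eta t)).
  move=> ta; apply: is_derive_eq (is_deriveB (flow_deriv eta' t ta) (flow_deriv eta t ta)) _.
  by ring.
have DE k t : is_derive t 1 (fun s => expR (k * s)) (expR (k * t) * k).
  have := is_derive1_comp (is_derive_expR (k * t)) (is_deriveZ k (is_derive_id t (1 : R))).
  by rewrite [k *: 1]mulr1.
have DS k t : `|t| < a -> is_derive t 1 (fun s => D s ^+ 2 * expR (k * s))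
    ((2 * D t * (d (flow eta' t) - d (flow eta t)) + k * D t ^+ 2) * expR (k * t)).
  move=> ta; apply: is_derive_eq (is_deriveM (is_derive_sqr _ _ _ (DD t ta)) (DE k t)) _.
  by rewrite /GRing.scale /=; ring.
have B t : `|2 * D t * (d (flow eta' t) - d (flow eta t))| <= 3 * D t ^+ 2.
  have h1 := d_lipschitz (flow eta' t) (flow eta t); rewrite -/(D t) in h1.
  rewrite 2!normrM (ger0_norm (_ : 0 <= 2)) // -[X in _ <= 3 * X]real_normK ?num_real //.
  by have := normr_ge0 (D t); nra.
have key : D h ^+ 2 * (1 - 3 * `|h|) <= D 0 ^+ 2.
  have E k : D h ^+ 2 * (1 + k * h) <= D h ^+ 2 * expR (k * h).
    by rewrite ler_wpM2l ?sqr_ge0 // expR_ge1Dx.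
  have [h0|h0] := leP 0 h.
    have [t ht|t _] := mean_value (fun s => D s ^+ 2 * expR (-3 * s))
      (fun t => (2 * D t * (d (flow eta' t) - d (flow eta t)) + -3 * D t ^+ 2) * expR (-3 * t)) 0 h.
      by apply: DS; apply: le_lt_trans ha; have := between_dist _ _ _ ht; rewrite !subr0.
    have := E (-3); have := B t; rewrite ler_norml => /andP[b1 b2].
    rewrite mulr0 expR0 mulr1 subr0 mulNr (ger0_norm h0) => e1 e2.
    have : (2 * D t * (d (flow eta' t) - d (flow eta t)) + -3 * D t ^+ 2) * expR (- 3 * t) * h <= 0.
      by rewrite mulr_le0_ge0 // mulr_le0_ge0 ?expR_ge0 //; lra.
    by rewrite mulNr in e2 *; lra.
  have [t ht|t _] := mean_value (fun s => D s ^+ 2 * expR (3 * s))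
      (fun t => (2 * D t * (d (flow eta' t) - d (flow eta t)) + 3 * D t ^+ 2) * expR (3 * t)) h 0.
    apply: DS; apply: le_lt_trans ha; rewrite orbC in ht.
    by have := between_dist _ _ _ ht; rewrite !subr0.
  have := E 3; have := B t; rewrite ler_norml => /andP[b1 b2].
  rewrite mulr0 expR0 mulr1 sub0r (ltr0_norm h0) => e1 e2.
  have : 0 <= (2 * D t * (d (flow eta' t) - d (flow eta t)) + 3 * D t ^+ 2) * expR (3 * t) * (- h).
    by rewrite mulr_ge0 ?mulr_ge0 ?expR_ge0 //; lra.
  by lra.
rewrite -/(D h) -(flow0 eta') -(flow0 eta) -/(D 0).
rewrite -ler_sqr ?nnegrE ?mulr_ge0 // exprMn !real_normK ?num_real //.
by have := sqr_ge0 (D h); move: ha key; rewrite /a; nra.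
Qed.

(** The integral of d' = g along the solution: its exponential solves the linearised equation and is
    the derivative of the flow in eta. *)
Definition flow_exponent eta h : R := prim (g \o flow eta) h.

Lemma flow_exponentP eta : flow_exponent eta 0 = 0 /\
  forall h, is_derive h 1 (flow_exponent eta) (g (flow eta h)).
Proof.
apply: primP => x; apply: continuous_comp; first exact: flow_continuous.
exact: g_continuous.
Qed.

Lemma flow_exponent_bound eta h : `|h| < a -> `|flow_exponent eta h| <= 1/8.
Proof.
move=> ha; have [E0 DE] := flow_exponentP eta.
have [c _] := mean_value _ _ 0 h (fun t _ => DE t).
rewrite E0 !subr0 => ->; rewrite normrM.
have /andP[h1 h2] := g_itv (flow eta c); rewrite ger0_norm; last by lra.
by have := normr_ge0 h; move: ha; rewrite /a; nra.
Qed.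

Lemma flow_exponent_lipschitz eta eta' h : `|h| < a ->
  `|flow_exponent eta' h - flow_exponent eta h| <= 15 * `|eta' - eta|.
Proof.
move=> ha; have [E0 DE] := flow_exponentP eta; have [E0' DE'] := flow_exponentP eta'.
have := mean_value_bound (flow_exponent eta' \- flow_exponent eta)
  ((g \o flow eta') \- (g \o flow eta)) 0 h (240 * `|eta' - eta|).
rewrite /= E0 E0' !subr0 => H; apply: (le_trans (H _)); last first.
  by have := normr_ge0 (eta' - eta); move: ha; rewrite /a; nra.
move=> t ht; split; first exact: is_deriveB (DE' t) (DE t).
have ta : `|t| < a.
  apply: le_lt_trans ha.
  by have := between_dist _ _ _ ht; rewrite !subr0.
have := flow_lipschitz eta eta' t ta; have := g_lip (flow eta' t) (flow eta t).
by lra.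
Qed.

(* The difference of two solutions agrees with its initial value times
   [expR (flow_exponent eta h)] up to a quadratic error. *)
Lemma flow_param_deriv eta h : `|h| < a ->
  is_derive eta 1 (flow^~ h) (expR (flow_exponent eta h)).
Proof.
move=> ha; have [E0 DE] := flow_exponentP eta; set E := flow_exponent eta in E0 DE *.
have quad eta' : `|flow eta' h - flow eta h - expR (E h) * (eta' - eta)|
    <= 200 * (eta' - eta) ^+ 2.
  pose D t := flow eta' t - flow eta t.
  pose m t := D t * expR (- E t).
  have Dm t : `|t| < a -> is_derive t 1 m
      ((d (flow eta' t) - d (flow eta t) - g (flow eta t) * D t) * expR (- E t)).
    move=> ta; have DN : is_derive t 1 (fun s => expR (- E s)) (expR (- E t) * - g (flow eta t)).
      exact: (is_derive1_comp (is_derive_expR _) (is_deriveN (DE t))).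
    have DB : is_derive t 1 D (d (flow eta' t) - d (flow eta t)).
      apply: is_derive_eq (is_deriveB (flow_deriv eta' t ta) (flow_deriv eta t ta)) _.
      by ring.
    apply: is_derive_eq (is_deriveM DB DN) _.
    by rewrite /GRing.scale /=; ring.
  (* For |x| <= 1/8 the inequality exp x >= 1 + x, used at x and - x, bounds both exponentials by
     8/7, since their product is 1. *)
  have Eb t : `|t| < a -> expR (E t) <= 8/7 /\ expR (- E t) <= 8/7.
    move=> ta; have := flow_exponent_bound eta t ta; rewrite -/(E t) ler_norml => /andP[? ?].
    have e1 := expR_ge1Dx (E t); have e2 := expR_ge1Dx (- E t).
    have := expR_gt0 (E t); have := expR_gt0 (- E t).
    have : expR (E t) * expR (- E t) = 1 by rewrite -expRD subrr expR0.
    by split; nra.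
  have := mean_value_bound m
    (fun t => (d (flow eta' t) - d (flow eta t) - g (flow eta t) * D t) * expR (- E t))
    0 h (120 * 4 * (eta' - eta) ^+ 2 * (8/7)).
  have m0 : m 0 = eta' - eta by rewrite /m /D !flow0 E0 oppr0 expR0 mulr1.
  rewrite m0 subr0 => H.
  have aux t : (0 <= t <= h) || (h <= t <= 0) -> `|t| < a.
    move=> ht; apply: le_lt_trans ha.
    by have := between_dist _ _ _ ht; rewrite !subr0.
  have {}H : `|m h - (eta' - eta)| <= 120 * 4 * (eta' - eta) ^+ 2 * (8/7) * `|h|.
    apply: H => t /aux ta; split; first exact: Dm.
    rewrite normrM (ger0_norm (expR_ge0 _)).
    have := d_linear (flow eta t) (flow eta' t); rewrite -/(D t).
    have := flow_lipschitz eta eta' t ta; rewrite -/(D t).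
    rewrite -ler_sqr ?nnegrE ?mulr_ge0 // exprMn !real_normK ?num_real // => l1 l2.
    by apply: ler_pM; rewrite ?expR_ge0 //; [lra|case: (Eb t ta)].
  have -> : flow eta' h - flow eta h - expR (E h) * (eta' - eta) =
      expR (E h) * (m h - (eta' - eta)).
    have xy : expR (E h) * expR (- E h) = 1 by rewrite -expRD subrr expR0.
    by rewrite /m -/(D h) -[X in X - _ = _]mulr1 -xy; ring.
  rewrite normrM (ger0_norm (expR_ge0 _)).
  have [Eh _] := Eb h ha; have := expR_ge0 (E h).
  have := sqr_ge0 (eta' - eta); have := normr_ge0 h.
  have : 120 * 4 * (eta' - eta) ^+ 2 * (8/7) * `|h| <= 120 * 4 * (eta' - eta) ^+ 2 * (8/7) * a.
    by rewrite ler_wpM2l ?(ltW ha) //; have := sqr_ge0 (eta' - eta); lra.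
  by rewrite /a; have := normr_ge0 (m h - (eta' - eta)); nra.
apply/is_derive_epsP => e e0; exists (e / 200).
  by rewrite divr_gt0 ?ltr0n.
move=> y; rewrite ltr_pdivlMr ?ltr0n // => yx; apply: (le_trans (quad y)).
rewrite -real_normK ?num_real // expr2 mulrA ler_wpM2r //; lra.
Qed.

(** * The pressure as a function of h and z *)

Hypothesis Dk : forall p, 0 < p -> p < 200^-1 ->
  is_derive p 1 (fun s => (g s)^-1)
    ((8 * p * g p - (g p)^-1 + 1 - 16/3 * d p) / p).

Let delta : R := 200^-1.
Let b : R := 20^-1.

Lemma g_neq0 x : g x != 0.
Proof. by have /andP[h1 h2] := g_itv x; rewrite gt_eqF //; lra. Qed.

Lemma d_growth s t : s <= t -> 4/5 * (t - s) <= d t - d s <= 4/3 * (t - s).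
Proof.
move=> st; have [c _ ->] := mean_value d g s t (fun t _ => Dd t).
by have /andP[h1 h2] := g_itv c; apply/andP; split; nra.
Qed.

(** Since d vanishes at 0, the quotient d^2/x tends to 0 there, in agreement with the convention for
    the inverse of 0; this makes [speed] continuous through r = 0. *)
Lemma d_sqr_ratio_lipschitz s t : 0 <= s -> s <= t ->
  `|d t ^+ 2 / t - d s ^+ 2 / s| <= 4 * (t - s).
Proof.
move=> s0 st.
have B x : 0 <= x -> 0 <= d x ^+ 2 / x <= 16/9 * x.
  move=> x0; have := d_growth 0 x x0; rewrite d0 !subr0 => /andP[h1 h2].
  rewrite divr_ge0 ?sqr_ge0 //=; have [->|xn0] := eqVneq x 0.
    by rewrite invr0 !mulr0.
  have xp : 0 < x by rewrite lt_def xn0.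
  by rewrite ler_pdivrMr //; nra.
have [e|sn0] := eqVneq s 0.
  move: (B t (le_trans s0 st)); rewrite e invr0 mulr0 !subr0 => /andP[h1 h2].
  by rewrite ger0_norm //; lra.
have sp : 0 < s by rewrite lt_def sn0.
have tp : 0 < t by exact: lt_le_trans st.
have -> : d t ^+ 2 / t - d s ^+ 2 / s =
    (d t + d s) * (d t - d s) / t - d s ^+ 2 / s * ((t - s) / t).
  by field; rewrite !gt_eqF.
have /andP[h1 h2] := d_growth s t st.
have := d_growth 0 t (ltW tp); have := d_growth 0 s s0.
rewrite d0 !subr0 => /andP[h3 h4] /andP[h5 h6].
have /andP[h7 h8] := B s s0.
have h9 : 0 <= (d t + d s) * (d t - d s) / t <= 4 * (t - s).
  have tp' := ltW tp; rewrite divr_ge0 ?mulr_ge0 //=; [|lra|lra].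
  by rewrite ler_pdivrMr //; nra.
have h10 : 0 <= d s ^+ 2 / s * ((t - s) / t) <= 4 * (t - s).
  have e1 : 0 <= (t - s) / t by rewrite divr_ge0 // ?(ltW tp) // subr_ge0.
  have e2 : t * ((t - s) / t) = t - s by field; rewrite gt_eqF.
  by apply/andP; split; nra.
case/andP: h9 => ? ?; case/andP: h10 => ? ?.
by rewrite ler_norml; apply/andP; split; lra.
Qed.

(* [speed] is dr/dz along the line h = 0, where the pressure is r^2. *)
Definition speed_sqr c : R :=
  12 * d (clip 0 delta c) + 3/2 * (g (clip 0 delta c))^-1
  - 3 * (d (clip 0 delta c) ^+ 2 / clip 0 delta c).

Definition speed r : R := Num.sqrt (speed_sqr (r ^+ 2)) / 2.

Lemma speed_sqr_bounds c : 1 <= speed_sqr c <= 4.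
Proof.
have dd : 0 <= delta by rewrite invr_ge0 ler0n.
rewrite /speed_sqr; have /andP[] := clip_itv 0 delta c dd.
move: (clip 0 delta c) => x x0 xd.
have := d_growth 0 x x0; rewrite d0 !subr0 => /andP[h1 h2].
have := d_sqr_ratio_lipschitz 0 x (lexx _) x0.
rewrite invr0 mulr0 !subr0 ler_norml => /andP[h3 h4].
have := inv_itv (4/5) (4/3) (g x) ltac:(lra) (g_itv x).
by move: xd; rewrite /delta => xd /andP[h5 h6]; apply/andP; split; lra.
Qed.

Lemma speed_bounds r : 1/2 <= speed r <= 1.
Proof.
have /andP[h1 h2] := speed_sqr_bounds (r ^+ 2); rewrite /speed.
have := ler_wsqrtr h1; have := ler_wsqrtr h2; rewrite sqrtr1.
have -> : 4 = 2 ^+ 2 :> R by ring.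
by rewrite sqrtr_sqr normr_nat => ? ?; apply/andP; split; lra.
Qed.

Lemma speed_continuous : continuous speed.
Proof.
have cr : continuous (fun c => d (clip 0 delta c) ^+ 2 / clip 0 delta c).
  apply: (lipschitz_continuous _ 4) => // x y.
  have cl := clip_lipschitz 0 delta x y.
  have dd : 0 <= delta by rewrite invr_ge0 ler0n.
  have /andP[x0 _] := clip_itv 0 delta x dd; have /andP[y0 _] := clip_itv 0 delta y dd.
  have [h|/ltW h] := leP (clip 0 delta x) (clip 0 delta y).
    rewrite distrC; apply: le_trans (d_sqr_ratio_lipschitz _ _ x0 h) _.
    by have := ler_norm (clip 0 delta y - clip 0 delta x); rewrite distrC; lra.
  apply: le_trans (d_sqr_ratio_lipschitz _ _ y0 h) _.
  by have := ler_norm (clip 0 delta x - clip 0 delta y); lra.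
have cc := clip_continuous 0 delta.
have cS : continuous speed_sqr.
  move=> x; rewrite /speed_sqr; apply: cvgB; last first.
    by apply: cvgM; [exact: cvg_cst|exact: cr].
  apply: cvgD; apply: cvgM; try exact: cvg_cst.
    by apply: continuous_comp; [exact: cc|exact: d_continuous].
  apply: cvgV; first exact: g_neq0.
  by apply: continuous_comp; [exact: cc|exact: g_continuous].
move=> r; rewrite /speed; apply: cvgM; last exact: cvg_cst.
apply: continuous_comp; last exact: sqrt_continuous.
apply: continuous_comp; last exact: cS.
exact: exprn_continuous.
Qed.

(** Separation of variables: z is a primitive of 1/speed as a function of r, and 1/speed >= 1 makes
    it invertible. *)
Lemma radius_ex : exists rad : R -> R,
  rad 0 = 0 /\ forall z, is_derive z 1 rad (speed (rad z)).
Proof.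
have cV : continuous (fun r => (speed r)^-1).
  move=> r; apply: cvgV; last exact: speed_continuous.
  by have /andP[h1 h2] := speed_bounds r; rewrite gt_eqF //; lra.
have [A0 DA] := primP _ cV.
have [|rad [radK _ Drad]] := inverse_ex _ _ 1 ltr01 _ DA.
  move=> r; have /andP[h1 h2] := inv_itv (1/2) 1 _ ltac:(lra) (speed_bounds r).
  by rewrite -[1]invr1.
exists rad; split; first by rewrite -{1}A0 radK.
by move=> z; apply: (is_derive_eq (Drad z)); rewrite invrK.
Qed.

Definition radius : R -> R := sval (cid radius_ex).

Lemma radius0 : radius 0 = 0.
Proof. by rewrite /radius; case: cid => r []. Qed.

Lemma radius_deriv z : is_derive z 1 radius (speed (radius z)).
Proof. by rewrite /radius; case: cid => r []. Qed.

Lemma radius_continuous : continuous radius.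
Proof. by move=> z; exact: is_derive_continuous (radius_deriv z). Qed.

Lemma radius_growth z : exists2 c, 1/2 <= c <= 1 & radius z = c * z.
Proof.
have [c _] := mean_value _ _ 0 z (fun t _ => radius_deriv t).
rewrite radius0 !subr0 => e.
by exists (speed (radius c)) => //; exact: speed_bounds.
Qed.

Lemma radius_sqr_bounds z : z ^+ 2 / 4 <= radius z ^+ 2 <= z ^+ 2.
Proof.
have [c /andP[h1 h2] ->] := radius_growth z; have := sqr_ge0 z.
have : 1/4 <= c ^+ 2 <= 1 by apply/andP; split; nra.
by rewrite exprMn => /andP[? ?] ?; apply/andP; split; nra.
Qed.

(** The value r(z)^2 on the line h = 0 is carried along h by the flow; [press_h] and [press_z] are
    the formulas for the two partial derivatives. *)
Definition press h z : R := flow (radius z ^+ 2) h.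
Definition press_h h z : R := h / 4 + d (press h z).
Definition press_z h z : R :=
  2 * radius z * speed (radius z) * expR (flow_exponent (radius z ^+ 2) h).

Lemma press_bounds h z : `|h| < a ->
  7/32 * z ^+ 2 + h ^+ 2 / 16 <= press h z <= 9/8 * z ^+ 2 + 3/16 * h ^+ 2.
Proof.
move=> ha; have /andP[h1 h2] := radius_sqr_bounds z.
have /andP[h3 h4] := flow_bounds (radius z ^+ 2) h (sqr_ge0 _) (ltW ha).
by rewrite /press; apply/andP; split; lra.
Qed.

Lemma press_lt h z : `|h| < a -> `|z| < b -> press h z < 200^-1.
Proof.
move=> ha zb; have /andP[_ h2] := press_bounds h z ha; apply: le_lt_trans h2 _.
have -> : h ^+ 2 = `|h| ^+ 2 by rewrite real_normK // num_real.
have -> : z ^+ 2 = `|z| ^+ 2 by rewrite real_normK // num_real.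
move: ha zb (normr_ge0 h) (normr_ge0 z); rewrite /a /b => ? ? ? ?.
have : `|h| ^+ 2 <= (16^-1) ^+ 2 by rewrite ler_sqr ?nnegrE // ltW.
have : `|z| ^+ 2 <= (20^-1) ^+ 2 by rewrite ler_sqr ?nnegrE // ltW.
by lra.
Qed.

Lemma press_gt0 h z : `|h| < a -> (h != 0) || (z != 0) -> 0 < press h z.
Proof.
move=> ha hz; have /andP[h1 _] := press_bounds h z ha; apply: lt_le_trans h1.
have := sqr_ge0 h; have := sqr_ge0 z; case/orP: hz.
  by move=> ? ? ?; have : 0 < h ^+ 2 by [rewrite exprn_even_gt0]; lra.
by move=> ? ? ?; have : 0 < z ^+ 2 by [rewrite exprn_even_gt0]; lra.
Qed.

Lemma press_deriv_h h z : `|h| < a -> is_derive h 1 (press^~ z) (press_h h z).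
Proof. exact: flow_deriv. Qed.

Lemma press_deriv_z h z : `|h| < a -> is_derive z 1 (press h) (press_z h z).
Proof.
move=> ha; have DS := is_derive_sqr _ _ _ (radius_deriv z).
apply: is_derive_eq (is_derive_chain (flow^~ h) _ _ _ _
  (flow_param_deriv _ _ ha) DS) _.
by rewrite /press_z mulrC.
Qed.

Lemma press_z_deriv_h h z : `|h| < a ->
  is_derive h 1 (press_z^~ z) (g (press h z) * press_z h z).
Proof.
move=> ha; have [_ DE] := flow_exponentP (radius z ^+ 2).
have DX := is_derive_chain _ _ _ _ _ (is_derive_expR _) (DE h).
apply: is_derive_eq (is_derive_scal (2 * radius z * speed (radius z)) _ _ _ DX) _.
by rewrite /press_z /press; ring.
Qed.


(** This decides which square root of the energy is the derivative in z. *)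
Lemma press_z_sign h z : 0 < z * press_z h z \/ z = 0.
Proof.
have [->|zn0] := eqVneq z 0; [by right|left].
have [c /andP[h1 h2] e] := radius_growth z; rewrite /press_z.
have -> : z * (2 * radius z * speed (radius z) * expR (flow_exponent (radius z ^+ 2) h))
  = 2 * c * z ^+ 2 * (speed (radius z) * expR (flow_exponent (radius z ^+ 2) h)).
  by rewrite {1}e; ring.
have z2 : 0 < z ^+ 2 by rewrite lt_def sqr_ge0 expf_eq0 /= zn0.
have /andP[s1 s2] := speed_bounds (radius z).
by apply: mulr_gt0; [apply: mulr_gt0 => //|apply: mulr_gt0; last exact: expR_gt0]; lra.
Qed.

Lemma continuous2P (f : R -> R -> R) (x y : R) :
  {for (x, y), continuous (fun q : R * R => f q.1 q.2)} <->
  forall e, 0 < e -> exists2 r, 0 < r & forall x' y', `|x' - x| < r ->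
    `|y' - y| < r -> `|f x' y' - f x y| <= e.
Proof.
split=> [cf e e0|H].
  have /cvgrPdist_le/(_ e e0) := cf; rewrite near_simpl => /nbhs_ballP[r r0 hr].
  exists r => // x' y' hx hy; rewrite distrC; apply: (hr (x', y')).
  by split; rewrite /ball /= distrC.
apply/cvgrPdist_le => e e0; have [r r0 hr] := H e e0.
exists (ball x r, ball y r); first by split; exact: nbhsx_ballx.
move=> -[x' y'] [/= hx hy].
rewrite /ball /= in hx hy.
by rewrite distrC; apply: hr; rewrite distrC.
Qed.

Lemma continuous_snd_comp (f : R -> R) (x y : R) : {for y, continuous f} ->
  {for (x, y), continuous (fun q : R * R => f q.2)}.
Proof.
move=> cf; apply: (@continuous_comp _ _ _ snd f); last exact: cf.
exact: cvg_snd.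
Qed.

Lemma param_lipschitz_continuous2 (F : R -> R -> R) (phi : R -> R) l h z :
  0 < l -> `|h| < a -> continuous phi -> {for h, continuous (F (phi z))} ->
  (forall eta eta' h, `|h| < a -> `|F eta' h - F eta h| <= l * `|eta' - eta|) ->
  {for (h, z), continuous (fun q : R * R => F (phi q.2) q.1)}.
Proof.
move=> l0 ha cphi cF lF; apply/(continuous2P (fun h z => F (phi z) h)) => e e0.
have e4 : 0 < e / (2 * l) by rewrite divr_gt0 // mulr_gt0.
have e2 : 0 < e / 2 by rewrite divr_gt0.
have [r1 r10 H1] := (continuousP_eps _ _).1 (cphi z) _ e4.
have [r2 r20 H2] := (continuousP_eps _ _).1 cF _ e2.
exists (Num.min (Num.min r1 r2) (a - `|h|)).
  by rewrite !lt_min r10 r20 /=; lra.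
move=> h' z'; rewrite !lt_min => /andP[/andP[_ hr2] hra] /andP[/andP[zr1 _] _].
have h'a : `|h'| < a by have := lerB_dist h' h; lra.
have := lF (phi z) (phi z') h' h'a.
have := H2 h' hr2.
have := ler_distD (F (phi z) h') (F (phi z') h') (F (phi z) h).
have : l * `|phi z' - phi z| <= e / 2.
  have -> : e / 2 = l * (e / (2 * l)) by field; rewrite gt_eqF.
  by rewrite ler_pM2l //; exact: H1.
by lra.
Qed.

Let radius_sqr_continuous : continuous (fun z => radius z ^+ 2).
Proof.
by move=> t; apply: cvgM; exact: radius_continuous.
Qed.

Lemma press_continuous h z : `|h| < a ->
  {for (h, z), continuous (fun q : R * R => press q.1 q.2)}.
Proof.
move=> ha; apply: (param_lipschitz_continuous2 flow (fun z => radius z ^+ 2) 2) => //.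
  exact: flow_continuous.
exact: flow_lipschitz.
Qed.

Lemma press_z_continuous h z : `|h| < a ->
  {for (h, z), continuous (fun q : R * R => press_z q.1 q.2)}.
Proof.
move=> ha; rewrite /press_z; apply: cvgM.
  apply: (continuous_snd_comp (fun z => 2 * radius z * speed (radius z))).
  apply: cvgM; first by apply: cvgM; [exact: cvg_cst|exact: radius_continuous].
  by apply: continuous_comp; [exact: radius_continuous|exact: speed_continuous].
apply: continuous_comp; last exact: continuous_expR.
apply: (param_lipschitz_continuous2 flow_exponent (fun z => radius z ^+ 2) 15) => //.
  exact: is_derive_continuous ((flow_exponentP _).2 h).
exact: flow_exponent_lipschitz.
Qed.

Lemma press_h_continuous h z : `|h| < a ->
  {for (h, z), continuous (fun q : R * R => press_h q.1 q.2)}.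
Proof.
move=> ha; rewrite /press_h; apply: cvgD.
  by apply: cvgM; [exact: cvg_fst|exact: cvg_cst].
by apply: continuous_comp; [exact: press_continuous|exact: d_continuous].
Qed.

(* [energy] is the explicit form of (dp/dz)^2, and [press_zz] half of its
   derivative in p. *)
Definition energy h p : R :=
  p * (12 * (h / 4 + d p) + 3/2 * (g p)^-1) - 4 * (3/4 + h) * (h / 4 + d p) ^+ 2.

Definition press_zz h p : R :=
  2 * (h / 4 + d p) + (3/4 + h) + 12 * p * g p
  - 4 * (3/4 + h) * (h / 4 + d p) * g p.

Lemma energy_continuous h : continuous (energy h).
Proof.
have cq : continuous (fun p => h / 4 + d p).
  by move=> p; apply: cvgD; [exact: cvg_cst|exact: d_continuous].
have cg : continuous (fun p => (g p)^-1).
  by move=> p; apply: cvgV; [exact: g_neq0|exact: g_continuous].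
move=> p; rewrite /energy; apply: cvgB.
  apply: cvgM; first exact: cvg_id.
  by apply: cvgD; apply: cvgM; try exact: cvg_cst; [exact: cq|exact: cg].
by apply: cvgM; [exact: cvg_cst|apply: cvgM; exact: cq].
Qed.

Lemma press_zz_continuous h : continuous (press_zz h).
Proof.
have cq : continuous (fun p => h / 4 + d p).
  by move=> p; apply: cvgD; [exact: cvg_cst|exact: d_continuous].
move=> p; rewrite /press_zz; apply: cvgB.
  apply: cvgD.
    apply: cvgD; last exact: cvg_cst.
    by apply: cvgM; [exact: cvg_cst|exact: cq].
  apply: cvgM; last exact: g_continuous.
  by apply: cvgM; [exact: cvg_cst|exact: cvg_id].
apply: cvgM; last exact: g_continuous.
by apply: cvgM; [exact: cvg_cst|exact: cq].
Qed.

Lemma energy_deriv h p : 0 < p -> p < 200^-1 ->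
  is_derive p 1 (energy h) (2 * press_zz h p).
Proof.
move=> p0 pd; have Dq := is_derive_add _ _ _ _ _ (is_derive_const (h / 4) p) (Dd p).
have D1 := is_derive_add _ _ _ _ _ (is_derive_scal 12 _ _ _ Dq)
  (is_derive_scal (3/2) _ _ _ (Dk p p0 pd)).
have D2 := is_derive_sub _ _ _ _ _ (is_derive_mul _ _ _ _ _ (is_derive_ident p) D1)
  (is_derive_scal (4 * (3/4 + h)) _ _ _ (is_derive_sqr _ _ _ Dq)).
apply: (is_derive_eq D2); rewrite /press_zz.
by field; rewrite g_neq0 gt_eqF.
Qed.

(** The compatibility equation [Dk] turns the total derivative of the energy along h into 2 g times
    the energy, the linear equation that (dp/dz)^2 also satisfies. *)
Lemma energy_deriv_flow h z : `|h| < a -> `|z| < b -> z != 0 ->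
  is_derive h 1 (fun t => energy t (press t z))
    (2 * g (press h z) * energy h (press h z)).
Proof.
move=> ha zb z0; have Dp := press_deriv_h h z ha; rewrite /press_h in Dp.
have p0 : 0 < press h z by apply: press_gt0; rewrite // z0 orbT.
have pd := press_lt h z ha zb.
have D0 := is_derive_mul _ _ _ _ _ (is_derive_ident h) (is_derive_const 4^-1 h).
have Dq := is_derive_add _ _ _ _ _ D0 (is_derive_chain d _ _ _ _ (Dd _) Dp).
have Dkp := is_derive_chain _ (press^~ z) _ _ _ (Dk _ p0 pd) Dp.
have D1 := is_derive_mul _ _ _ _ _ Dp (is_derive_add _ _ _ _ _
  (is_derive_scal 12 _ _ _ Dq) (is_derive_scal (3/2) _ _ _ Dkp)).
have Dw := is_derive_add _ _ _ _ _ (is_derive_const (3/4) h) (is_derive_ident h).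
have D2 := is_derive_mul _ _ _ _ _ (is_derive_scal 4 _ _ _ Dw) (is_derive_sqr _ _ _ Dq).
apply: (is_derive_eq (is_derive_sub _ _ _ _ _ D1 D2)); rewrite /energy.
by field; rewrite g_neq0 gt_eqF.
Qed.

(** Both sides are their values at h = 0 times the exponential of twice [flow_exponent], and at h =
    0 they agree by the choice of [speed]. *)
Lemma press_z_sqr_offaxis h z : `|h| < a -> `|z| < b -> z != 0 ->
  press_z h z ^+ 2 = energy h (press h z).
Proof.
move=> ha zb z0; have [E0 DE] := flow_exponentP (radius z ^+ 2).
move: (ha); rewrite ltr_norml => /andP[ha1 ha2].
have := linear_ode (fun t => energy t (press t z))
  (fun t => 2 * g (press t z)) (fun t => 2 * flow_exponent (radius z ^+ 2) t) a h.
rewrite E0 mulr0 => /(_ erefl ha1 ha2) H.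
have -> : energy h (press h z) =
    energy 0 (press 0 z) * expR (2 * flow_exponent (radius z ^+ 2) h).
  apply: H => t t1 t2.
  by apply: energy_deriv_flow; rewrite // ltr_norml t1.
have rn0 : radius z ^+ 2 != 0.
  have /andP[r1 _] := radius_sqr_bounds z; rewrite gt_eqF //.
  by apply: lt_le_trans r1; rewrite divr_gt0 // exprn_even_gt0.
(* Below [delta] the clipping inside [speed_sqr] is the identity. *)
have rd : radius z ^+ 2 <= delta.
  have /andP[_ r2] := radius_sqr_bounds z; apply: (le_trans r2).
  rewrite -real_normK ?num_real //; have := normr_ge0 z.
  by move: zb; rewrite /delta /b; nra.
rewrite /energy /press flow0 /press_z /speed !exprMn sqr_sqrtr; last first.
  by have /andP[? ?] := speed_sqr_bounds (radius z ^+ 2); lra.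
have -> : expR (2 * flow_exponent (radius z ^+ 2) h) =
    expR (flow_exponent (radius z ^+ 2) h) ^+ 2.
  by rewrite [RHS]expr2 -expRD; congr expR; ring.
rewrite /speed_sqr clip_id ?sqr_ge0 //.
by field; rewrite g_neq0 /=; apply: contraNneq rn0 => ->; rewrite expr0n.
Qed.

Let press_slice_continuous h z : `|h| < a -> {for z, continuous (press h)}.
Proof. by move=> ha; exact: is_derive_continuous (press_deriv_z h z ha). Qed.

Lemma press_z_slice_continuous h z : `|h| < a -> {for z, continuous (press_z h)}.
Proof.
move=> ha; apply/continuousP_eps => e e0.
have [r r0 H] := (continuous2P press_z h z).1 (press_z_continuous h z ha) e e0.
by exists r => // y yz; apply: H; rewrite // subrr normr0.
Qed.

(** Continuity in z carries the identity over to z = 0. *)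
Lemma press_z_sqr h z : `|h| < a -> `|z| < b ->
  press_z h z ^+ 2 = energy h (press h z).
Proof.
move=> ha zb; have [z0|] := eqVneq z 0; last exact: press_z_sqr_offaxis.
pose f y := press_z h y ^+ 2 - energy h (press h y).
have cf : {for 0, continuous f}.
  apply: cvgB; first by apply: cvgM; exact: press_z_slice_continuous.
  apply: continuous_comp; first exact: press_slice_continuous.
  exact: energy_continuous.
apply/eqP; rewrite -subr_eq0 z0 -/(f 0) -normr_le0; apply/ler_addgt0Pl => e e0.
have [r r0 H] := (continuousP_eps f 0).1 cf e e0.
pose y := Num.min r b / 2.
have rb : 0 < Num.min r b by rewrite lt_min r0 /b; lra.
have hr : Num.min r b <= r by rewrite ge_min lexx.
have hb : Num.min r b <= b by rewrite ge_min lexx orbT.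
have y0 : 0 < y by rewrite divr_gt0.
have := H y; rewrite subr0 (gtr0_norm y0) => /(_ _).
rewrite {1}/f press_z_sqr_offaxis ?gt_eqF //; last by rewrite (gtr0_norm y0) /y; lra.
by rewrite subrr sub0r normrN addr0; apply; rewrite /y; lra.
Qed.

(* On z = 0 the square root of the energy is not differentiable; the derivative
   there is the limit of the derivatives at z <> 0. *)
Lemma press_z_deriv_z h z : `|h| < a -> `|z| < b ->
  is_derive z 1 (press_z h) (press_zz h (press h z)).
Proof.
move=> ha zb.
have off y : y != 0 -> `|y| < b -> is_derive y 1 (press_z h) (press_zz h (press h y)).
  move=> y0 yb.
  have p0 : 0 < press h y by apply: press_gt0; rewrite // y0 orbT.
  have pd := press_lt h y ha yb.
  have De := is_derive_chain _ _ _ _ _ (energy_deriv h _ p0 pd) (press_deriv_z h y ha).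
  have [zp|] := press_z_sign h y; last by move/eqP: y0.
  have e0 : 0 < energy h (press h y).
    rewrite -press_z_sqr // exprn_even_gt0 //=.
    by apply: contraTneq zp => ->; rewrite mulr0 ltxx.
  have Ds := is_derive_chain Num.sqrt (fun t => energy h (press h t)) _ _ _
    (is_derive1_sqrt e0) De.
  have pz0 : press_z h y != 0 by apply: contraTneq zp => ->; rewrite mulr0 ltxx.
  have nb : \forall t \near y, `|t| < b.
    exists (b - `|y|) => [/=|t /= ty]; first by lra.
    by have := lerB_dist t y; rewrite distrC in ty; lra.
  (* The derivative in z is minus the square root of the energy for y < 0 and plus it for y > 0. *)
  have [yp|yn|/eqP] := ltgtP y 0; last by rewrite (negbTE y0).
  - have pzn t : t < 0 -> press_z h t <= 0.
      move=> t0; have [|t0'] := press_z_sign h t; last by rewrite t0' ltxx in t0.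
      by rewrite nmulr_rgt0 // => /ltW.
    have Ds' := is_derive_scal (-1) _ _ _ Ds.
    apply: near_eq_is_derive (is_derive_eq Ds' _); last first.
      rewrite -press_z_sqr // sqrtr_sqr ler0_norm ?pzn //.
      by field.
    near=> t; have tb : `|t| < b by near: t; exact: nb.
    have t0 : t < 0 by near: t; exact: lt_nbhsl.
    by rewrite -press_z_sqr // sqrtr_sqr (ler0_norm (pzn t t0)) mulN1r opprK.
  - have pzp t : 0 < t -> 0 <= press_z h t.
      move=> t0; have [|t0'] := press_z_sign h t; last by rewrite t0' ltxx in t0.
      by rewrite pmulr_rgt0 // => /ltW.
    apply: near_eq_is_derive (is_derive_eq Ds _); last first.
      rewrite -press_z_sqr // sqrtr_sqr ger0_norm ?pzp //.
      by field.
    near=> t; have tb : `|t| < b by near: t; exact: nb.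
    have t0 : 0 < t by near: t; exact: lt_nbhsr.
    by rewrite -press_z_sqr // sqrtr_sqr (ger0_norm (pzp t t0)).
have [z0|/off] := eqVneq z 0; last exact.
apply: (is_derive_limit _ (fun y => press_zz h (press h y)) _ b).
- by rewrite invr_gt0 ltr0n.
- by move=> y; rewrite z0 subr0; exact: off.
- exact: press_z_slice_continuous.
- apply: continuous_comp; first exact: press_slice_continuous.
  exact: press_zz_continuous.
Unshelve. all: by end_near. Qed.

Lemma press_diff h z : `|h| < a -> is_diff (h, z)
  (fun q : R * R => press q.1 q.2) (fun v => press_h h z * v.1 + press_z h z * v.2).
Proof.
move=> ha; apply: (is_diff_partial press press_h _ _ _ (a - `|h|)).
- by rewrite subr_gt0.
- by move=> h' z' hh _; apply: press_deriv_h; have := lerB_dist h' h; lra.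
- exact/(continuous2P press_h h z)/press_h_continuous.
- exact: press_deriv_z.
Qed.

Lemma press_z_diff h z : `|h| < a -> `|z| < b -> is_diff (h, z)
  (fun q : R * R => press_z q.1 q.2)
  (fun v => g (press h z) * press_z h z * v.1 + press_zz h (press h z) * v.2).
Proof.
move=> ha zb; apply: (is_diff_partial press_z
  (fun h z => g (press h z) * press_z h z) _ _ _ (a - `|h|)).
- by rewrite subr_gt0.
- by move=> h' z' hh _; apply: press_z_deriv_h; have := lerB_dist h' h; lra.
- apply/(continuous2P (fun h z => g (press h z) * press_z h z) h z).
  apply: cvgM; last exact: press_z_continuous.
  by apply: continuous_comp; [exact: press_continuous|exact: g_continuous].
- exact: press_z_deriv_z.
Qed.

End flow.

(** The interface to the construction in space: profile, pressure and its z-derivative, with the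
    proofs on which they depend hidden. *)
Lemma pressure_ex (R : realType) : exists (g d : R -> R) (P Pz : R -> R -> R),
  [/\ forall x, 4/5 <= g x <= 4/3,
      d 0 = 0,
      forall x : R, is_derive x 1 d (g x) &
      forall p : R, 0 < p -> p < 200^-1 -> is_derive p 1 (fun s => (g s)^-1)
        ((8 * p * g p - (g p)^-1 + 1 - 16/3 * d p) / p)] /\
  forall h z : R, `|h| < 16^-1 -> `|z| < 20^-1 ->
  [/\ 7/32 * z ^+ 2 + h ^+ 2 / 16 <= P h z <= 9/8 * z ^+ 2 + 3/16 * h ^+ 2,
      P h z < 200^-1,
      Pz h z ^+ 2 = energy g d h (P h z),
      is_diff (h, z) (fun q : R * R => P q.1 q.2)
        (fun v => (h / 4 + d (P h z)) * v.1 + Pz h z * v.2) &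
      is_diff (h, z) (fun q : R * R => Pz q.1 q.2)
        (fun v => g (P h z) * Pz h z * v.1 + press_zz g d h (P h z) * v.2)].
Proof.
have [g [d [gl gi d0 Dd Dk]]] := @profile_ex R.
exists g, d, (press g d gl gi d0 Dd), (press_z g d gl gi d0 Dd); split=> // h z ha zb.
split.
- exact: press_bounds.
- exact: press_lt.
- exact: press_z_sqr.
- exact: press_diff.
- exact: press_z_diff.
Qed.

(** * The compactly supported flow *)

Section cutoff.
Context {R : realType}.
Implicit Types (x y t s p : R).

(** Squaring the positive part makes it differentiable at 0. *)
Definition ramp s : R := Num.max 0 s ^+ 2.

Lemma ramp_deriv s : is_derive s 1 ramp (2 * Num.max 0 s).
Proof.
apply/is_derive_epsP => e e0; exists e => // y ys.
have H : `|ramp y - ramp s - 2 * Num.max 0 s * (y - s)| <= (y - s) ^+ 2.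
  rewrite /ramp ler_norml; have := sqr_ge0 (y - s); have := sqr_ge0 y.
  have := sqr_ge0 s; move=> ? ? ?.
  by case: (leP 0 y) => ?; case: (leP 0 s) => ?; apply/andP; split; nra.
apply: (le_trans H); rewrite -real_normK ?num_real // expr2 ler_wpM2r // ltW //.
Qed.

(* In the domain |h| < 1/16, |z| < 1/20 of the local solution, {p < t2} lies in
   |h| <= 1/32, |z| <= 1/40; and [cutoff] also vanishes for p <= t1, where the
   swirl is not smooth. *)
Let t2 : R := 128^-1 ^+ 2.
Let t1 : R := t2 / 2.
Let t20 : 0 < t2. Proof. by rewrite exprn_gt0. Qed.
Let t10 : 0 < t1. Proof. by rewrite divr_gt0. Qed.
Let t12 : t1 < t2. Proof. by have := t20; rewrite /t1; lra. Qed.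

Definition cutoff t : R := ramp ((t - t1) * (t2 - t)).

Lemma cutoff_deriv t : exists l, is_derive t 1 cutoff l.
Proof.
have Da := is_derive_sub _ _ _ _ _ (is_derive_ident t) (is_derive_const t1 t).
have Db := is_derive_sub _ _ _ _ _ (is_derive_const t2 t) (is_derive_ident t).
have Dab := is_derive_mul _ _ _ _ _ Da Db.
by eexists; apply: is_derive_chain (ramp_deriv _) Dab.
Qed.

Lemma cutoff_eq0 t : (t <= t1) || (t2 <= t) -> cutoff t = 0.
Proof.
rewrite /cutoff /ramp => h; rewrite (max_idPl _) ?expr0n //.
by have := t12; case/orP: h => h; nra.
Qed.

Lemma cutoff_gt0 t : t1 < t -> t < t2 -> 0 < cutoff t.
Proof.
move=> h1 h2; rewrite /cutoff /ramp exprn_gt0 // lt_max mulr_gt0 ?orbT // subr_gt0 //.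
Qed.

Lemma cutoff_continuous : continuous cutoff.
Proof. by move=> t; have [l] := cutoff_deriv t; exact: is_derive_continuous. Qed.

(** The new pressure Phi with Phi' = phi^2, normalised to vanish from [t2] on so that it extends by
    zero. *)
Definition cutoff_prim t : R := prim (fun s => cutoff s ^+ 2) t - prim (fun s => cutoff s ^+ 2) t2.

Lemma cutoff_prim_deriv t : is_derive t 1 cutoff_prim (cutoff t ^+ 2).
Proof.
have [|_ D] := @primP R (fun s => cutoff s ^+ 2).
  by move=> s; apply: cvgM; exact: cutoff_continuous.
apply: is_derive_eq (is_derive_sub _ _ _ _ _ (D t) (is_derive_const _ t)) _.
by rewrite subr0.
Qed.

Lemma cutoff_prim_eq0 t : t2 <= t -> cutoff_prim t = 0.
Proof.
move=> tt; have [c hc] := mean_value _ _ t2 t (fun s _ => cutoff_prim_deriv s).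
rewrite {2}/cutoff_prim subrr subr0 => ->; rewrite cutoff_eq0 ?expr0n ?mul0r //.
by case/orP: hc => /andP[h1 h2]; rewrite ?h1 ?orbT //; apply/orP; right; lra.
Qed.

Section swirl.
Variables g d : R -> R.
Hypothesis g_itv : forall x, 4/5 <= g x <= 4/3.
Hypothesis d0 : d 0 = 0.
Hypothesis Dd : forall x, is_derive x 1 d (g x).
Hypothesis Dk : forall p, 0 < p -> p < 200^-1 ->
  is_derive p 1 (fun s => (g s)^-1)
    ((8 * p * g p - (g p)^-1 + 1 - 16/3 * d p) / p).

(* The square of s times the azimuthal velocity, before the cutoff. *)
Definition swirl_sqr p : R := p * (9/4 - 3/2 * (g p)^-1 - 12 * d p).

Lemma swirl_sqr_gt0 p : 0 < p -> p < 200^-1 -> 0 < swirl_sqr p.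
Proof.
move=> p0 pd; rewrite /swirl_sqr mulr_gt0 //.
have /andP[h1 h2] := inv_itv (4/5) (4/3) (g p) ltac:(lra) (g_itv p).
have := d_growth g d g_itv Dd 0 p (ltW p0).
by rewrite d0 !subr0 => /andP[? ?]; lra.
Qed.

Definition swirl p : R := cutoff p * Num.sqrt (swirl_sqr p).

(** For p <= t1 both sides vanish with the cutoff; for p > t1 the quantity under the root is
    positive. *)
Lemma swirl_sqrE p : p < 200^-1 -> swirl p ^+ 2 = cutoff p ^+ 2 * swirl_sqr p.
Proof.
move=> pd; have [p1|p1] := leP p t1.
  by rewrite /swirl cutoff_eq0 ?p1 // !mul0r expr0n mul0r.
rewrite /swirl exprMn sqr_sqrtr // ltW // swirl_sqr_gt0 //.
exact: lt_trans p1.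
Qed.

(** Below [t1] the swirl is locally zero; from [t1] on, p is positive and the root is taken of a
    positive quantity. *)
Lemma swirl_deriv p : p < 200^-1 -> exists l, is_derive p 1 swirl l.
Proof.
move=> pd; have [p1|p1] := ltP p t1.
  exists 0; apply: near_eq_is_derive (is_derive_const 0 p).
  near=> s; rewrite /swirl cutoff_eq0 ?mul0r //.
  by apply/orP; left; apply/ltW; near: s; exact: lt_nbhsl.
have p0 : 0 < p by exact: lt_le_trans p1.
have [l Dl] := cutoff_deriv p.
have Ds := is_derive_mul _ _ _ _ _ (is_derive_ident p) (is_derive_sub _ _ _ _ _
  (is_derive_sub _ _ _ _ _ (is_derive_const (9/4) p)
    (is_derive_scal (3/2) _ _ _ (Dk p p0 pd))) (is_derive_scal 12 _ _ _ (Dd p))).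
have Dr := is_derive_chain Num.sqrt swirl_sqr _ _ _
  (is_derive1_sqrt (swirl_sqr_gt0 p p0 pd)) Ds.
by eexists; exact: is_derive_mul Dl Dr.
Unshelve. all: by end_near. Qed.

End swirl.

End cutoff.

(** * The Euler flow in Cartesian coordinates *)

Section torus.
Context {R : realType}.
Notation V := 'rV[R]_3.
Implicit Types (x y z h T : R) (p q : V).

(* ph and pz are the partial derivatives of the pressure in h = w - 3/4 and in z.
   The first relation is |v|^2 = 3 p; with it, the second is the radial momentum
   balance. *)
Lemma momentum_relations (h t g k d ph pz pzz w B : R) :
  ph = h / 4 + d -> w = 3/4 + h -> g * k = 1 ->
  pz ^+ 2 = t * (12 * ph + 3/2 * k) - 4 * w * ph ^+ 2 ->
  pzz = 2 * ph + w + 12 * t * g - 4 * w * ph * g ->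
  B = t * (9/4 - 3/2 * k - 12 * d) ->
  pz ^+ 2 + B = w * (3 * t - 4 * ph ^+ 2) /\
  ph * pzz - g * pz ^+ 2 = 2 * ph ^+ 2 + w * ph - 3/2 * t.
Proof.
move=> -> -> gk -> -> ->; split; first by field.
have -> : g * (t * (12 * (h / 4 + d) + 3/2 * k) - 4 * (3/4 + h) * (h / 4 + d) ^+ 2) =
  12 * t * g * (h / 4 + d) + 3/2 * t * (g * k) - 4 * (3/4 + h) * (h / 4 + d) ^+ 2 * g.
  by field.
by rewrite gk; field.
Qed.

Let a : R := 16^-1.
Let b : R := 20^-1.

Variable T : R.

(** The coordinates h, w and z at a point of space, the torus being centred at height [T] on the
    third axis. *)
Let hx q : R := q 0 0 * q 0 0 + q 0 1 * q 0 1 - 3/4.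
Let wx q : R := q 0 0 * q 0 0 + q 0 1 * q 0 1.
Let zx q : R := q 0 2%R - T.

Let grad_wx p : grad_at wx p (2 * p 0 0) (2 * p 0 1) 0.
Proof.
apply: grad_at_eq (grad_at_add _ _ _ _ _ _ _ _ _
  (grad_at_mul _ _ _ _ _ _ _ _ _ (grad_at_coord p 0) (grad_at_coord p 0))
  (grad_at_mul _ _ _ _ _ _ _ _ _ (grad_at_coord p 1) (grad_at_coord p 1))) _ _ _ => /=;
  by ring.
Qed.

Let grad_hx p : grad_at hx p (2 * p 0 0) (2 * p 0 1) 0.
Proof.
by apply: grad_at_eq (grad_at_add _ _ _ _ _ _ _ _ _ (grad_wx p)
  (grad_at_const (- (3/4)) p)) _ _ _; rewrite addr0.
Qed.

Let grad_zx p : grad_at zx p 0 0 1.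
Proof.
by apply: grad_at_eq (grad_at_add _ _ _ _ _ _ _ _ _ (grad_at_coord p 2%R)
  (grad_at_const (- T) p)) _ _ _; rewrite /= addr0.
Qed.

(** Two open sets covering space: the local solution lives on [inside], the cut-off flow vanishes on
    [outer], and they overlap. *)
Let inside q := (`|hx q| < a) && (`|zx q| < b).
Let outer q := (a / 2 < `|hx q|) || (b / 2 < `|zx q|).

Let hx_continuous : continuous hx.
Proof. by move=> p; exact/differentiable_continuous/grad_at_differentiable/grad_hx. Qed.

Let zx_continuous : continuous zx.
Proof. by move=> p; exact/differentiable_continuous/grad_at_differentiable/grad_zx. Qed.

Let near_norm_lt (f : V -> R) p (r : R) : continuous f -> `|f p| < r ->
  \forall q \near p, `|f q| < r.
Proof. by move=> cf fr; exact: (@cvgr_norm_lt _ _ _ _ _ f (f p) (cf p) r fr). Qed.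

Let near_norm_gt (f : V -> R) p (r : R) : continuous f -> r < `|f p| ->
  \forall q \near p, r < `|f q|.
Proof. by move=> cf fr; exact: (@cvgr_norm_gt _ _ _ _ _ f (f p) (cf p) r fr). Qed.

Let near_inside p : inside p -> \forall q \near p, inside q.
Proof.
move=> /andP[h1 h2].
have H1 := near_norm_lt _ _ _ hx_continuous h1.
have H2 := near_norm_lt _ _ _ zx_continuous h2.
by apply: filterS2 H1 H2 => q ? ?; apply/andP.
Qed.

Let near_outer p : outer p -> \forall q \near p, outer q.
Proof.
case/orP => h.
  by apply: filterS (near_norm_gt _ _ _ hx_continuous h) => q ?; apply/orP; left.
by apply: filterS (near_norm_gt _ _ _ zx_continuous h) => q ?; apply/orP; right.
Qed.

Let inside_or_outer p : inside p \/ outer p.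
Proof.
have [h1|h1] := ltP `|hx p| a; last by right; apply/orP; left; rewrite /a in h1 *; lra.
have [h2|h2] := ltP `|zx p| b; last by right; apply/orP; right; rewrite /b in h2 *; lra.
by left; apply/andP.
Qed.

(** The field is the cut-off axisymmetric flow on [inside] and zero elsewhere. Since it vanishes on
    all of [outer], every point has a neighbourhood where a single differentiable formula holds, and
    there the balance reduces to [momentum_relations]. *)
Lemma torus_components : exists u0 u1 u2 pr : V -> R,
  [/\ forall p, exists a0 b0 c0 a1 b1 c1 a2 b2 c2 a3 b3 c3 : R,
       [/\ grad_at u0 p a0 b0 c0, grad_at u1 p a1 b1 c1, grad_at u2 p a2 b2 c2 &
           grad_at pr p a3 b3 c3] /\
       [/\ u0 p * a0 + u1 p * b0 + u2 p * c0 = - a3,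
           u0 p * a1 + u1 p * b1 + u2 p * c1 = - b3,
           u0 p * a2 + u1 p * b2 + u2 p * c2 = - c3 &
           a0 + b1 + c2 = 0],
      forall p, ~~ inside p -> [/\ u0 p = 0, u1 p = 0, u2 p = 0 & pr p = 0] &
      exists p, u2 p != 0].
Proof.
have [g [d [P [Pz [[g_itv d0 Dd Dk] HP]]]]] := pressure_ex R.
pose pq q := P (hx q) (zx q).
(* With stream function p the radial velocity is -p_z/s, the azimuthal one swirl/s, the vertical one
   2 p_h. Cartesian components involve only w = s^2, which stays positive on [inside]. *)
pose al q := cutoff (pq q) * (Pz (hx q) (zx q) * (wx q)^-1).
pose be q := swirl g d (pq q) * (wx q)^-1.
pose ga q := 2 * (cutoff (pq q) * (hx q * 4^-1 + d (pq q))).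
pose u0 q := if inside q then (-1) * (al q * q 0 0) + (-1) * (be q * q 0 1) else 0.
pose u1 q := if inside q then (-1) * (al q * q 0 1) + be q * q 0 0 else 0.
pose u2 q := if inside q then ga q else 0.
pose pr q := if inside q then cutoff_prim (pq q) else 0.
have sqr_norm_gt (c y : R) : 0 <= c -> c < `|y| -> c ^+ 2 <= y ^+ 2.
  by move=> c0 cy; rewrite -(real_normK (num_real y)) ler_sqr ?nnegrE // ltW.
have outer0 q : outer q -> [/\ u0 q = 0, u1 q = 0, u2 q = 0 & pr q = 0].
  rewrite /u0 /u1 /u2 /pr; case: ifP => // /andP[h1 h2] oq.
  have [/andP[lb _] _ _ _ _] := HP _ _ h1 h2.
  have pt : 128^-1 ^+ 2 <= pq q.
    apply: le_trans lb; have zz := sqr_ge0 (zx q); have hh := sqr_ge0 (hx q).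
    case/orP: oq => oq.
      have : 0 <= a / 2 by rewrite /a; lra.
      by move=> /sqr_norm_gt/(_ oq); rewrite /a; lra.
    have : 0 <= b / 2 by rewrite /b; lra.
    by move=> /sqr_norm_gt/(_ oq); rewrite /b; lra.
  have c0 : cutoff (pq q) = 0 by rewrite cutoff_eq0 // pt orbT.
  rewrite /al /be /ga /swirl c0 !mul0r !mulr0 addr0; split=> //.
  exact: cutoff_prim_eq0.
exists u0, u1, u2, pr; split; last 2 first.
- by move=> p /negbTE np; rewrite /u0 /u1 /u2 /pr np.
- have z0 : `|0 : R| < b by rewrite normr0 /b.
  have h32 h : 0 <= h <= 32^-1 -> `|h| < a.
    by move=> /andP[h1 h2]; rewrite ger0_norm // /a; lra.
  have [|||h hI hv] := @IVT R (P^~ 0) 0 32^-1 (3/4 * 128^-1 ^+ 2).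
  (* On z = 0 the pressure goes from 0 at h = 0 to at least 128^-2 at h = 1/32, so it takes the
     value 3/4 * 128^-2, strictly between the two thresholds of the cutoff; there the vertical
     velocity is positive. *)
  + by rewrite invr_ge0.
  + apply: continuous_in_subspaceT => h; rewrite inE /= in_itv /= => /h32 ha.
    have [_ _ _ DP _] := HP h 0 ha z0.
    have cP := differentiable_continuous (@ex_diff _ _ _ _ _ _ _ DP).
    apply: (@continuous_comp _ _ _ (fun h => (h, 0)) (fun q : R * R => P q.1 q.2)).
      by apply: differentiable_continuous; apply: differentiable_pair;
        [exact: ex_diff|exact: differentiable_cst].
    exact: cP.
  + have [/andP[l0 r0] _ _ _ _] := HP 0 0 (h32 0 ltac:(lra)) z0.
    have [/andP[l1 r1] _ _ _ _] := HP 32^-1 0 (h32 32^-1 ltac:(lra)) z0.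
    rewrite ge_min le_max; apply/andP; split; apply/orP; [left|right]; lra.
  have hh : 0 <= h <= 32^-1 by move: hI; rewrite in_itv.
  have [s ss] : exists s, s * s = 3/4 + h.
    exists (Num.sqrt (3/4 + h)); rewrite -expr2 sqr_sqrtr //; lra.
  exists (row3 s 0 T).
  have hE : hx (row3 s 0 T) = h by rewrite /hx row3E0 row3E1 ss; ring.
  have zE : zx (row3 s 0 T) = 0 by rewrite /zx row3E2 subrr.
  rewrite /u2 /inside hE zE h32 // z0 /= /ga /pq hE zE hv.
  have t20 : 0 < 128^-1 ^+ 2 :> R by rewrite exprn_gt0.
  have := d_growth g d g_itv Dd 0 (3/4 * 128^-1 ^+ 2) ltac:(lra).
  rewrite d0 !subr0 => /andP[d1 _].
  rewrite gt_eqF // mulr_gt0 // mulr_gt0 //; last by lra.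
  by apply: cutoff_gt0; lra.
move=> p; have [ip|op] := inside_or_outer p; last first.
  exists 0, 0, 0, 0, 0, 0, 0, 0, 0, 0, 0, 0; split; last by rewrite !mulr0 !addr0 oppr0.
  have no := near_outer p op.
  split; apply: grad_at_near (grad_at_const 0 p);
    by apply: filterS no => q /outer0 [? ? ? ?].
have [h1 h2] := andP ip.
have [_ plt en DP DPz] := HP _ _ h1 h2.
have wp : 0 < wx p.
  move: h1; rewrite ltr_norml => /andP[h1 _]; move: h1; rewrite /hx -/(wx p) /a; lra.
have Gp := grad_at_chain2 _ _ _ _ _ _ _ _ _ _ _ _ DP (grad_hx p) (grad_zx p).
have Gpz := grad_at_chain2 _ _ _ _ _ _ _ _ _ _ _ _ DPz (grad_hx p) (grad_zx p).
rewrite /= in Gp Gpz.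
(* The derivatives [l] and [m] cancel in the final identities, because the field is tangent to the
   levels of p. *)
have [l Dl] := cutoff_deriv (pq p).
have [m Dm] := swirl_deriv g d g_itv d0 Dd Dk (pq p) plt.
have Gcut := grad_at_chain _ _ _ _ _ _ _ Dl Gp.
have Gsw := grad_at_chain _ _ _ _ _ _ _ Dm Gp.
have Gd := grad_at_chain _ _ _ _ _ _ _ (Dd (pq p)) Gp.
have Gpr := grad_at_chain _ _ _ _ _ _ _ (cutoff_prim_deriv (pq p)) Gp.
have wn0 : wx p != 0 by rewrite gt_eqF.
have Dinv : is_derive (wx p) 1 (fun s => s^-1) (- (wx p) ^- 2).
  by apply: is_derive_eq (is_deriveV _ _) _; rewrite ?[_ *: 1]mulr1.
have Gw := grad_at_chain _ _ _ _ _ _ _ Dinv (grad_wx p).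
have Gal := grad_at_mul _ _ _ _ _ _ _ _ _ Gcut
  (grad_at_mul _ _ _ _ _ _ _ _ _ Gpz Gw).
have Gbe := grad_at_mul _ _ _ _ _ _ _ _ _ Gsw Gw.
have Gh4 := grad_at_mul _ _ _ _ _ _ _ _ _ (grad_hx p) (grad_at_const 4^-1 p).
have Gga := grad_at_mul _ _ _ _ _ _ _ _ _ (grad_at_const 2 p)
  (grad_at_mul _ _ _ _ _ _ _ _ _ Gcut (grad_at_add _ _ _ _ _ _ _ _ _ Gh4 Gd)).
have G0 := grad_at_add _ _ _ _ _ _ _ _ _
  (grad_at_mul _ _ _ _ _ _ _ _ _ (grad_at_const (-1) p)
    (grad_at_mul _ _ _ _ _ _ _ _ _ Gal (grad_at_coord p 0)))
  (grad_at_mul _ _ _ _ _ _ _ _ _ (grad_at_const (-1) p)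
    (grad_at_mul _ _ _ _ _ _ _ _ _ Gbe (grad_at_coord p 1))).
have G1 := grad_at_add _ _ _ _ _ _ _ _ _
  (grad_at_mul _ _ _ _ _ _ _ _ _ (grad_at_const (-1) p)
    (grad_at_mul _ _ _ _ _ _ _ _ _ Gal (grad_at_coord p 1)))
  (grad_at_mul _ _ _ _ _ _ _ _ _ Gbe (grad_at_coord p 0)).
have ni := near_inside p ip.
do 12 eexists; split.
  split; [apply: grad_at_near G0|apply: grad_at_near G1|
    apply: grad_at_near Gga|apply: grad_at_near Gpr];
  by apply: filterS ni => q iq; rewrite /u0 /u1 /u2 /pr iq.
rewrite /u0 /u1 /u2 ip /=.
have sw2 := swirl_sqrE g d g_itv d0 Dd (pq p) plt.
have gn0 := g_neq0 g g_itv (pq p).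
have wE : wx p = 3/4 + hx p by rewrite /hx /wx; ring.
have [] := @momentum_relations (hx p) (pq p) (g (pq p)) (g (pq p))^-1 (d (pq p))
  (hx p / 4 + d (pq p)) (Pz (hx p) (zx p)) (press_zz g d (hx p) (pq p)) (wx p)
  (swirl_sqr g d (pq p)) erefl wE (divff gn0) _ _ erefl.
- rewrite en /energy -/(pq p) wE; ring.
- by rewrite /press_zz wE.
move=> R1 R2.
have R1' : cutoff (pq p) ^+ 2 * Pz (hx p) (zx p) ^+ 2 + swirl g d (pq p) ^+ 2
    - cutoff (pq p) ^+ 2 * (wx p * (3 * pq p - 4 * (hx p / 4 + d (pq p)) ^+ 2)) = 0.
  by rewrite sw2 -R1; ring.
move/eqP: R2; rewrite -subr_eq0 => /eqP R2.
rewrite /al /be /ga -/(pq p) !mulr0 !addr0.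
have wxE : wx p = p 0 0 * p 0 0 + p 0 1 * p 0 1 by [].
move: R1' R2 wn0 wxE {en DP DPz Gp Gpz Dl Dm Gcut Gsw Gd Gpr Dinv Gw Gal Gbe Gh4 Gga G0 G1 wE R1 sw2}.
move: (hx p / 4 + d (pq p)) => ph; move: (press_zz g d (hx p) (pq p)) => G.
move: (Pz (hx p) (zx p)) => pz; move: (cutoff (pq p)) => ch.
move: (swirl g d (pq p)) => sw; move: (g (pq p)) => gt; move: (pq p) => t.
move: (wx p) => w; move: (p 0 0) => X; move: (p 0 1) => Y R1 R2 wn0 wE.
split.
- apply: subr0_eq.
  (* Each horizontal residual is an explicit combination of the two relations, which both read 0
     here. *)
  transitivity (- X / w ^+ 2 *
    (ch ^+ 2 * pz ^+ 2 + sw ^+ 2 - ch ^+ 2 * (w * (3 * t - 4 * ph ^+ 2)))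
    - 2 * X * ch ^+ 2 / w *
    (ph * G - gt * pz ^+ 2 - (2 * ph ^+ 2 + w * ph - 3 / 2 * t))); last first.
    by rewrite R1 R2 !mulr0 subrr.
  by rewrite wE; field; rewrite -wE.
- apply: subr0_eq.
  transitivity (- Y / w ^+ 2 *
    (ch ^+ 2 * pz ^+ 2 + sw ^+ 2 - ch ^+ 2 * (w * (3 * t - 4 * ph ^+ 2)))
    - 2 * Y * ch ^+ 2 / w *
    (ph * G - gt * pz ^+ 2 - (2 * ph ^+ 2 + w * ph - 3 / 2 * t))); last first.
    by rewrite R1 R2 !mulr0 subrr.
  by rewrite wE; field; rewrite -wE.
(* The vertical balance is an identity: on a level of p the vertical velocity is the constant cutoff
   factor times h/2 plus a constant, and the flow stays on levels. The divergence vanishes by the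
   stream function form. *)
- by rewrite wE; field; rewrite -wE.
- by rewrite wE; field; rewrite -wE.
Qed.

Lemma torus_flow : exists (u : V -> V) (pr : V -> R),
  [/\ forall p, differentiable u p /\ differentiable pr p,
      forall p, advect3 u p = - grad3 pr p /\ div3 u p = 0,
      forall p, 1 <= `|p 0 2%R - T| \/ 1 <= p 0 0 ^+ 2 + p 0 1 ^+ 2 ->
        u p = 0 /\ pr p = 0 &
      exists p, u p != 0].
Proof.
have [u0 [u1 [u2 [pr [H out [p0 p0n]]]]]] := torus_components.
exists (fun q => row3 (u0 q) (u1 q) (u2 q)), pr; split.
- move=> p; have [a0 [b0 [c0 [a1 [b1 [c1 [a2 [b2 [c2 [a3 [b3 [c3]]]]]]]]]]]] := H p.
  move=> [[G0 G1 G2 G3] _]; split; last exact: grad_at_differentiable G3.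
  by apply: differentiable_row3; apply: grad_at_differentiable; [exact: G0|exact: G1|exact: G2].
- move=> p; have [a0 [b0 [c0 [a1 [b1 [c1 [a2 [b2 [c2 [a3 [b3 [c3]]]]]]]]]]]] := H p.
  move=> [[G0 G1 G2 G3] [E0 E1 E2 E3]].
  rewrite (advect3E _ _ _ _ _ _ _ _ _ _ _ _ _ G0 G1 G2) (grad3E _ _ _ _ _ G3).
  rewrite (div3E _ _ _ _ _ _ _ _ _ _ _ _ _ G0 G1 G2) E0 E1 E2 E3; split=> //.
  by apply/rowP => -[[|[|[|//]]]] Hi; rewrite !mxE.
- move=> p far; have [|-> -> -> ->] := out p; last first.
    by split=> //; apply/rowP => -[[|[|[|//]]]] Hi; rewrite !mxE.
  (* On [inside], w < 13/16 and |z - T| < 1/20, so both distances are below 1. *)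
  apply/negP => /andP[]; rewrite /zx /hx /a /b ltr_norml => /andP[h1 h2] h3.
  by case: far => far; rewrite ?expr2 in far; lra.
- exists p0; apply: contraNneq p0n => /rowP/(_ 2%R); rewrite !mxE /= => ->.
  by [].
Qed.

End torus.

(** * The volume of a ball and the equilibrium radius *)

Section volume.
Context {R : realType}.
Notation mu := (@lebesgue_measure R).
Notation mR := (measurableTypeR R).

Definition ball_set (r : R) : set (mR * mR * mR) :=
  [set q | q.1.1 ^+ 2 + q.1.2 ^+ 2 + q.2 ^+ 2 < r ^+ 2].

Lemma ball_setE (r : R) : 0 < r -> tr3 @^-1` ball3 r = ball_set r.
Proof.
move=> r0; apply/funext => -[[x y] z]; rewrite /ball3 /ball_set /=; apply/propext.
have -> : enorm3 (tr3 (x, y, z)) = Num.sqrt (x ^+ 2 + y ^+ 2 + z ^+ 2).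
  by rewrite /enorm3 /dot3 !big_ord_recl big_ord0 /tr3 !mxE /= addr0 addrA !expr2.
rewrite -{1}(ger0_norm (ltW r0)) -sqrtr_sqr ltr_sqrt ?exprn_gt0 //.
Qed.

Lemma measurable_ball_set (r : R) : measurable (ball_set r).
Proof.
have mf : measurable_fun [set: mR * mR * mR]
    (fun q : mR * mR * mR => q.1.1 ^+ 2 + q.1.2 ^+ 2 + q.2 ^+ 2 : mR).
  apply: measurable_funD; last by apply: measurable_funX; exact: measurable_snd.
  apply: measurable_funD; apply: measurable_funX.
    by apply: measurableT_comp; [exact: measurable_fst|exact: measurable_fst].
  by apply: measurableT_comp; [exact: measurable_snd|exact: measurable_fst].
have := mf measurableT `]-oo, r ^+ 2[%classic (measurable_itv _).
rewrite setTI; congr (measurable _); apply/seteqP; split=> q /=;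
  by rewrite in_itv.
Qed.

Definition box (r : R) : set mR := `]-r, r[.

Lemma measure_box (r : R) : 0 < r -> mu (box r) = (2 * r)%:E.
Proof.
move=> r0; rewrite lebesgue_measure_itv /= lte_fin ifT; last lra.
by rewrite -EFinB; congr EFin; ring.
Qed.

Lemma measure_square (r : R) : 0 < r ->
  (mu \x mu)%E (box r `*` box r) = ((2 * r) ^+ 2)%:E.
Proof.
move=> r0; rewrite product_measure1E; [|exact: measurable_itv|exact: measurable_itv].
by rewrite /= !measure_box // -EFinM expr2.
Qed.

Lemma measure_cube (r : R) : 0 < r ->
  leb3 R ((box r `*` box r) `*` box r) = ((2 * r) ^+ 3)%:E.
Proof.
move=> r0; rewrite /leb3 product_measure1E;
  [|by apply: measurableX; exact: measurable_itv|exact: measurable_itv].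
by rewrite /= measure_square // measure_box // -EFinM -exprSr.
Qed.

Lemma measurable_cube (r : R) : measurable ((box r `*` box r) `*` box r).
Proof. by do 2?[apply: measurableX]; exact: measurable_itv. Qed.

Definition volume (r : R) : \bar R := leb3 R (ball_set r).

Lemma volume_le_cube (r : R) : 0 < r -> (volume r <= ((2 * r) ^+ 3)%:E)%E.
Proof.
move=> r0; rewrite -measure_cube // /volume /leb3; apply: le_measure.
- by rewrite inE; exact: measurable_ball_set.
- by rewrite inE; exact: measurable_cube.
- move=> [[x y] z]; rewrite /ball_set /box /= !in_itv /= => h.
  have H t : t ^+ 2 < r ^+ 2 -> - r < t < r.
    by move=> tr; apply/andP; split; nra.
  have := sqr_ge0 x; have := sqr_ge0 y; have := sqr_ge0 z => ? ? ?.
  by split; [split|]; apply: H; lra.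
Qed.

(** The cube of half-side r/2 fits in the ball: its points have squared norm below 3/4 r^2. *)
Lemma volume_ge_cube (r : R) : 0 < r -> ((r ^+ 3)%:E <= volume r)%E.
Proof.
move=> r0; have r20 : 0 < r / 2 by rewrite divr_gt0.
have -> : r ^+ 3 = (2 * (r / 2)) ^+ 3 by congr (_ ^+ 3); field.
rewrite -measure_cube // /volume /leb3; apply: le_measure.
- by rewrite inE; exact: measurable_cube.
- by rewrite inE; exact: measurable_ball_set.
- move=> [[x y] z]; rewrite /ball_set /box /= !in_itv /=.
  by move=> [[/andP[? ?] /andP[? ?]] /andP[? ?]]; nra.
Qed.

(** The square root of a negative number is 0, so the formula also covers points whose vertical
    section is empty. *)
Lemma ball_section (r : R) (q : mR * mR) :
  mu (xsection (ball_set r) q) =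
  (2 * Num.sqrt (r ^+ 2 - (q.1 ^+ 2 + q.2 ^+ 2)))%:E.
Proof.
case: q => x y; set t := r ^+ 2 - _.
have -> : xsection (ball_set r) (x, y) = [set` `]- Num.sqrt t, Num.sqrt t[].
  apply/seteqP; split=> z; rewrite /xsection /ball_set /= inE /= in_itv /=.
    move=> h; rewrite -ltr_norml -sqrtr_sqr ltr_sqrt; rewrite /t /=; first by lra.
    by have := sqr_ge0 z; lra.
  rewrite -ltr_norml -sqrtr_sqr => h.
  have t0 : 0 < t.
    by rewrite -sqrtr_gt0; apply: le_lt_trans h; exact: sqrtr_ge0.
  by move: h; rewrite ltr_sqrt // /t /=; lra.
rewrite lebesgue_measure_itv /= lte_fin.
have [t0|t0] := ltP 0 (Num.sqrt t).
  by rewrite ifT; [rewrite -EFinB; congr EFin; ring|lra].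
have -> : Num.sqrt t = 0 by apply/eqP; rewrite eq_le t0 sqrtr_ge0.
by rewrite oppr0 ltxx mulr0.
Qed.

Lemma sqrt_sub_le (s t : R) : s <= t -> Num.sqrt t <= Num.sqrt s + Num.sqrt (t - s).
Proof.
move=> st; have [s0|s0] := leP 0 s; last first.
  have -> : Num.sqrt s = 0 by apply: ler0_sqrtr; exact: ltW.
  by rewrite add0r; apply: ler_wsqrtr; lra.
have h1 := sqrtr_ge0 s; have h2 := sqrtr_ge0 (t - s).
rewrite -[X in _ <= X]ger0_norm ?addr_ge0 // -sqrtr_sqr; apply: ler_wsqrtr.
rewrite sqrrD !sqr_sqrtr ?subr_ge0 //.
by have := mulr_ge0 h1 h2; rewrite mulr2n; lra.
Qed.

(* Vertical sections: |sqrt a - sqrt b| <= sqrt |a - b|, integrated over a square. *)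
Lemma volume_modulus (s t : R) : 0 < s -> s <= t ->
  (volume t <= volume s + (2 * Num.sqrt (t ^+ 2 - s ^+ 2) * (2 * t) ^+ 2)%:E)%E.
Proof.
move=> s0 st; have t0 : 0 < t by exact: lt_le_trans st.
have mt := measurable_fun_xsection mu (measurable_ball_set t).
have ms := measurable_fun_xsection mu (measurable_ball_set s).
have mB : measurable (box t `*` box t) by apply: measurableX; exact: measurable_itv.
set c := 2 * Num.sqrt _; have c0 : 0 <= c by rewrite mulr_ge0 ?sqrtr_ge0.
(* The excess of chord length is bounded by [c] over the square and is 0 off it, where the chord of
   the larger ball is already empty. *)
pose ind q : \bar R := (c%:E * (\1_(box t `*` box t) q)%:E)%E.
have mI : measurable_fun [set: mR * mR] ind.
  by apply: measurable_funeM; apply/measurable_EFinP; exact: measurable_indic.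
have -> : (c * (2 * t) ^+ 2)%:E = (\int[(mu \x mu)%E]_q ind q)%E.
  have i0 q : [set: mR * mR] q -> (0 <= (\1_(box t `*` box t) q)%:E :> \bar R)%E.
    by move=> _; rewrite lee_fin.
  have mi : measurable_fun [set: mR * mR] (fun q => (\1_(box t `*` box t) q)%:E : \bar R).
    by apply/measurable_EFinP; exact: measurable_indic.
  rewrite /ind (ge0_integralZl _ _ mi i0) ?lee_fin //.
  by rewrite integral_indic // setIT /= measure_square // EFinM.
have volE u : volume u = (\int[(mu \x mu)%E]_q mu (xsection (ball_set u) q))%E by [].
rewrite !volE -ge0_integralD //; last first.
  by move=> q _; rewrite /ind mule_ge0 ?lee_fin.
apply: ge0_le_integral => //.
  by apply: emeasurable_funD.
move=> q _ /=; rewrite !ball_section /ind -EFinM -EFinD lee_fin.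
case: (boolP (q \in box t `*` box t)) => qB.
  rewrite indicE qB mulr1 -mulrDr ler_wpM2l //.
  have -> : t ^+ 2 - s ^+ 2 = t ^+ 2 - (q.1 ^+ 2 + q.2 ^+ 2) - (s ^+ 2 - (q.1 ^+ 2 + q.2 ^+ 2)).
    by ring.
  by apply: sqrt_sub_le; nra.
rewrite indicE (negbTE qB) mulr0 addr0.
suff -> : Num.sqrt (t ^+ 2 - (q.1 ^+ 2 + q.2 ^+ 2)) = 0.
  by rewrite mulr0 mulr_ge0 ?sqrtr_ge0.
apply: ler0_sqrtr; rewrite leNgt; apply/negP => h; move/negP: qB; apply.
rewrite inE /box /= !in_itv /=.
have H u : u ^+ 2 < t ^+ 2 -> - t < u < t.
  by move=> ut; apply/andP; split; nra.
by have := sqr_ge0 q.1; have := sqr_ge0 q.2; split; apply: H; lra.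
Qed.

End volume.

Section equilibrium.
Context {R : realType}.

Lemma real_volume_ex : exists vol : R -> R,
  [/\ forall r : R, 0 < r -> volume r = (vol r)%:E,
      forall r : R, 0 < r -> r ^+ 3 <= vol r <= (2 * r) ^+ 3,
      forall s t : R, 0 < s -> s <= t -> vol s <= vol t &
      forall s t : R, 0 < s -> s <= t ->
        vol t - vol s <= 8 * t ^+ 2 * Num.sqrt (t ^+ 2 - s ^+ 2)].
Proof.
have volE (r : R) : 0 < r -> volume r = (fine (volume r))%:E.
  move=> r0; rewrite fineK // ge0_fin_numE.
    by apply: le_lt_trans (volume_le_cube r r0) _; rewrite ltry.
  by apply: le_trans (volume_ge_cube r r0); rewrite lee_fin exprn_ge0 // ltW.
exists (fun r => fine (volume r)); split.
- exact: volE.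
- move=> r r0; apply/andP; split; rewrite -lee_fin -(volE r r0).
    exact: volume_ge_cube.
  exact: volume_le_cube.
- move=> s t s0 st; rewrite -lee_fin -(volE s s0) -(volE t (lt_le_trans s0 st)).
  rewrite /volume /leb3; apply: le_measure.
  + by rewrite inE; exact: measurable_ball_set.
  + by rewrite inE; exact: measurable_ball_set.
  + by move=> q; rewrite /ball_set /= => h; apply: lt_le_trans h _; nra.
- move=> s t s0 st; have := volume_modulus s t s0 st.
  rewrite (volE s s0) (volE t (lt_le_trans s0 st)) -EFinD lee_fin.
  by move: (fine _) (fine _) => x y /=; lra.
Qed.

Lemma modulus_continuous (v : R -> R) (r : R) : 0 < r ->
  (forall s t : R, 0 < s -> s <= t -> v s <= v t) ->
  (forall s t : R, 0 < s -> s <= t ->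
     v t - v s <= 8 * t ^+ 2 * Num.sqrt (t ^+ 2 - s ^+ 2)) ->
  {for r, continuous v}.
Proof.
move=> r0 vol_le vol_modulus.
have cm : {for r, continuous (fun y : R => Num.sqrt `|y ^+ 2 - r ^+ 2|)}.
  apply: continuous_comp; last exact: sqrt_continuous.
  apply: continuous_comp; last exact: norm_continuous.
  by apply: cvgB; [apply: cvgM; exact: cvg_id|exact: cvg_cst].
apply/continuousP_eps => e e0.
(* The constant is 8 (2 r)^2: both radii stay below 2 r. *)
have c0 : 0 < 32 * r ^+ 2 by rewrite mulr_gt0 // exprn_gt0.
have [d d0 H] := (continuousP_eps _ _).1 cm (e / (32 * r ^+ 2)) (divr_gt0 e0 c0).
exists (Num.min d (r / 2)); first by rewrite lt_min d0 divr_gt0.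
move=> y; rewrite lt_min => /andP[/H h]; rewrite ltr_norml => /andP[y1 y2].
have y0 : 0 < y by lra.
move: h; rewrite subrr normr0 sqrtr0 subr0 (ger0_norm (sqrtr_ge0 _)).
rewrite ler_pdivlMr // mulrC => h.
have [yr|/ltW ry] := leP y r.
  have v1 := vol_le y r y0 yr; have v2 := vol_modulus y r y0 yr.
  rewrite distrC ger0_norm ?subr_ge0 //; apply: le_trans h; apply: (le_trans v2).
  rewrite distrC ger0_norm; last by nra.
  by rewrite ler_wpM2r ?sqrtr_ge0 //; have := sqr_ge0 r; lra.
have v1 := vol_le r y r0 ry; have v2 := vol_modulus r y r0 ry.
rewrite ger0_norm ?subr_ge0 //; apply: le_trans h; apply: (le_trans v2).
rewrite ger0_norm; last by nra.
by rewrite ler_wpM2r ?sqrtr_ge0 //; nra.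
Qed.

(** With A = p_inf, B = 2 sigma and K = R_g T_inf M this is the mass constraint times R_g T_inf, the
    density being fixed by the pressure jump. The left side is continuous in r, small near 0 and
    large at infinity. *)
Lemma equilibrium_radius (A B K : R) : 0 < A -> 0 <= B -> 0 < K ->
  exists2 r, 0 < r & ((A + B / r)%:E * volume r)%E = K%:E.
Proof.
move=> A0 B0 K0.
have [vol [volE vol_bounds vol_le vol_modulus]] := real_volume_ex.
pose F r := (A + B / r) * vol r.
(* For r <= 1 the outer cube bounds F r by 8 A r^3 + 8 B r^2 <= c r, at most K at [r0]; for r >= 1
   the inner cube gives F r >= A r^3 >= A r, at least K at [r1]. *)
pose c := 8 * A + 8 * B.
have c0 : 0 < c by rewrite /c; lra.
pose r0 := Num.min 1 (K / c); pose r1 := Num.max 1 (K / A).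
have r00 : 0 < r0 by rewrite lt_min ltr01 divr_gt0.
have r01 : r0 <= 1 by rewrite ge_min lexx.
have r11 : 1 <= r1 by rewrite le_max lexx.
have F0 : F r0 <= K.
  have /andP[_ v] := vol_bounds r0 r00.
  have h : F r0 <= (A + B / r0) * (2 * r0) ^+ 3.
    by rewrite ler_wpM2l // addr_ge0 ?divr_ge0 // ltW.
  apply: (le_trans h).
  have -> : (A + B / r0) * (2 * r0) ^+ 3 = 8 * A * r0 ^+ 3 + 8 * B * r0 ^+ 2.
    by field; rewrite gt_eqF.
  have r2 : r0 ^+ 2 <= r0 by rewrite expr2 ger_pMr.
  have r3 : r0 ^+ 3 <= r0.
    by rewrite exprS; nra.
  have : c * r0 <= K by rewrite mulrC -ler_pdivlMr // ge_min lexx orbT.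
  have : 8 * A * r0 ^+ 3 <= 8 * A * r0 by rewrite ler_wpM2l // mulr_ge0 // ltW.
  have : 8 * B * r0 ^+ 2 <= 8 * B * r0 by rewrite ler_wpM2l // mulr_ge0.
  by rewrite /c; lra.
have F1 : K <= F r1.
  have r10 : 0 < r1 by lra.
  have /andP[v _] := vol_bounds r1 r10.
  have h : A * r1 ^+ 3 <= F r1.
    apply: ler_pM => //; [exact: ltW|by rewrite exprn_ge0 // ltW|].
    by rewrite lerDl divr_ge0 // ltW.
  apply: le_trans h.
  have : K <= A * r1 by rewrite mulrC -ler_pdivrMr // le_max lexx orbT.
  have : A * r1 <= A * r1 ^+ 3.
    by rewrite ler_pM2l // -[X in X <= _]expr1 ler_weXn2l.
  by lra.
have [||| r rI Fr] := @IVT R F r0 r1 K.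
- by apply: le_trans r11.
- apply: continuous_in_subspaceT => r; rewrite inE /= in_itv /= => /andP[rr _].
  have rp : 0 < r by exact: lt_le_trans rr.
  apply: cvgM; last exact: modulus_continuous.
  apply: cvgD; first exact: cvg_cst.
  apply: cvgM; first exact: cvg_cst.
  by apply: cvgV; [rewrite gt_eqF|exact: cvg_id].
- by rewrite ge_min le_max F0 F1 orbT.
have rp : 0 < r by move: rI; rewrite in_itv /= => /andP[rr _]; exact: lt_le_trans rr.
by exists r => //; rewrite volE // -EFinM; congr EFin.
Qed.

End equilibrium.

(** * The steady state *)

Section main_lemmas.
Context {R : realType}.
Notation V := 'rV[R]_3.

Lemma enorm3_sqr (p : V) : enorm3 p ^+ 2 = p 0 0 ^+ 2 + p 0 1 ^+ 2 + p 0 2%R ^+ 2.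
Proof.
rewrite /enorm3 sqr_sqrtr; first by rewrite dot3E -!expr2.
by rewrite sumr_ge0 // => i _; rewrite -expr2 sqr_ge0.
Qed.

Lemma enorm3_ge0 (p : V) : 0 <= enorm3 p.
Proof. exact: sqrtr_ge0. Qed.

Lemma enorm3_0 : enorm3 (0 : V) = 0.
Proof. by rewrite /enorm3 dot3E !mxE !mul0r !addr0 sqrtr0. Qed.

Lemma dot30l (p : V) : dot3 0 p = 0.
Proof. by rewrite dot3E !mxE !mul0r !addr0. Qed.

Lemma dpart_const (W : normedModType R) (k : W) (i : 'I_3) : dpart (fun=> k) i = fun=> 0.
Proof. by apply/funext => p; exact: derive_cst. Qed.

Lemma grad3_const (k : R) (p : V) : grad3 (fun=> k) p = 0.
Proof. by apply/rowP => i; rewrite !mxE dpart_const. Qed.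

Lemma lap3_const (k : R) (p : V) : lap3 (fun=> k) p = 0.
Proof. by rewrite /lap3 big1 // => i _; rewrite !dpart_const. Qed.

Lemma div3_const (k p : V) : div3 (fun=> k) p = 0.
Proof. by rewrite /div3 big1 // => i _; rewrite dpart_const mxE. Qed.

Lemma grad3_affine (u : V -> R) (k l : R) (p : V) : differentiable u p ->
  grad3 (fun q => k + l * u q) p = l *: grad3 u p.
Proof.
move=> du; apply/rowP => i; rewrite !mxE /dpart.
have dd : derivable u p (e3 i) by exact: diff_derivable.
have := @is_deriveD _ _ _ _ _ _ _ _ _ (is_derive_cst k p (e3 i)) (is_deriveZ l (derivableP dd)).
by case=> _ ->; rewrite add0r.
Qed.

(** Strict inequalities make the set open, so that a field vanishing on it has zero derivatives
    there. *)
Definition far (T : R) (p : V) := 1 < `|p 0 2%R - T| \/ 1 < p 0 0 ^+ 2 + p 0 1 ^+ 2.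

Lemma near_far T p : far T p -> \forall q \near p, far T q.
Proof.
case=> h.
  have G := grad_at_add _ _ _ _ _ _ _ _ _ (grad_at_coord p 2%R) (grad_at_const (- T) p).
  have cf := differentiable_continuous (grad_at_differentiable _ _ _ _ _ G).
  by apply: filterS (@cvgr_norm_gt _ _ _ _ _ _ _ cf _ h) => q ?; left.
have G := grad_at_add _ _ _ _ _ _ _ _ _
  (grad_at_mul _ _ _ _ _ _ _ _ _ (grad_at_coord p 0) (grad_at_coord p 0))
  (grad_at_mul _ _ _ _ _ _ _ _ _ (grad_at_coord p 1) (grad_at_coord p 1)).
have cf := differentiable_continuous (grad_at_differentiable _ _ _ _ _ G).
by apply: filterS (@cvgr_gt _ _ _ _ _ _ cf _ h) => q ?; right.
Qed.

(** If |z - T| <= 1 then z^2 <= (T + 1)^2, which falls short of (T + 3)^2 by more than 1. *)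
Lemma enorm3_far (T : R) (p : V) : 0 <= T -> T + 3 <= enorm3 p -> far T p.
Proof.
move=> T0 np; rewrite /far; have [h|h] := ltP 1 `|p 0 2%R - T|; [by left|right].
have : (T + 3) ^+ 2 <= enorm3 p ^+ 2 by rewrite ler_sqr ?nnegrE ?enorm3_ge0 //; lra.
rewrite enorm3_sqr; move: h; rewrite ler_norml => /andP[h1 h2].
have : p 0 2%R ^+ 2 <= (T + 1) ^+ 2 by nra.
by nra.
Qed.

End main_lemmas.

Theorem theorem2p1 (R : realType)
  (rho_l kappa sigma T_inf p_inf R_g c_v gamma M : R)
  (hrho_l : 0 < rho_l) (hkappa : 0 <= kappa) (hsigma : 0 < sigma)
  (hT : 0 < T_inf) (hp : 0 < p_inf) (hRg : 0 < R_g) (hcv : 0 < c_v)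
  (hgamma : gamma = 1 + R_g / c_v) (hM : 0 < M) :
  exists Rs : R, 0 < Rs /\
  exists (v_l : 'rV[R]_3 -> 'rV[R]_3) (p_l : 'rV[R]_3 -> R)
         (rho_g : 'rV[R]_3 -> R) (v_g : 'rV[R]_3 -> 'rV[R]_3) (p_g : R),
    (* classical regularity: liquid fields C^1 in the exterior and continuous
       up to the boundary; gas density twice differentiable, gas velocity
       differentiable in the bubble, both continuous up to the boundary *)
    (forall x, ext3 Rs x -> differentiable v_l x /\ differentiable p_l x) /\
    {within cext3 Rs, continuous v_l} /\ {within cext3 Rs, continuous p_l} /\
    (forall x, ball3 Rs x ->
       [/\ differentiable rho_g x,
           (forall i, differentiable (dpart rho_g i) x) &
           differentiable v_g x]) /\
    {within cball3 Rs, continuous rho_g} /\ {within cball3 Rs, continuous v_g} /\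
    (forall x, cball3 Rs x -> 0 < rho_g x) /\
    (* liquid: steady incompressible Euler in R^3 \ Omega *)
    (forall x, ext3 Rs x ->
       advect3 v_l x = - (rho_l^-1 *: grad3 p_l x) /\ div3 v_l x = 0) /\
    (* gas in Omega *)
    (forall x, ball3 Rs x ->
       div3 (fun y => rho_g y *: v_g y) x = 0 /\
       0 = kappa / (gamma * c_v) * lap3 (fun y => ln (rho_g y)) x
           - kappa / (gamma * c_v) * (enorm3 (grad3 rho_g x) ^+ 2 / rho_g x ^+ 2)
           - dot3 (v_g x) (grad3 rho_g x)) /\
    (* boundary conditions on the sphere |x| = Rs *)
    (forall x, sphere3 Rs x ->
       [/\ dot3 (v_l x) (normal_sphere Rs x) = 0,
           dot3 (v_g x) (normal_sphere Rs x) = 0,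
           p_g - p_l x = sigma * surfdiv_normal_sphere Rs &
           p_g = R_g * T_inf * rho_g x]) /\
    (* far-field conditions *)
    (exists C R0 : R, forall x, ext3 Rs x -> R0 <= enorm3 x ->
       enorm3 (v_l x) <= C / enorm3 x ^+ 2) /\
    (forall eps : R, 0 < eps -> exists R0 : R, forall x, ext3 Rs x ->
       R0 <= enorm3 x -> forall i, enorm3 (dpart v_l i x) <= eps) /\
    (forall eps : R, 0 < eps -> exists R0 : R, forall x, ext3 Rs x ->
       R0 <= enorm3 x -> `|p_l x - p_inf| <= eps) /\
    (* mass constraint *)
    (\int[leb3 R]_(q in tr3 @^-1` ball3 Rs) (rho_g (tr3 q))%:E = M%:E)%E /\
    (* nontrivial liquid flow *)
    (exists x, ext3 Rs x /\ v_l x != 0).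
Proof.
have RT0 : 0 < R_g * T_inf by rewrite mulr_gt0.
have [Rs Rs0 RsE] := equilibrium_radius p_inf (2 * sigma) (R_g * T_inf * M) hp
  ltac:(lra) (mulr_gt0 RT0 hM).
(* The flow vanishes unless |z - T| < 1, that is, it lives above the plane z = Rs, clear of the
   closed bubble. *)
pose T := Rs + 1.
have [u [pr [du ueq uout [x0 ux0]]]] := torus_flow T.
have in0 x : enorm3 x <= Rs -> u x = 0 /\ pr x = 0.
  move=> xR; apply: uout; left.
  have : enorm3 x ^+ 2 <= Rs ^+ 2 by rewrite ler_sqr ?nnegrE ?enorm3_ge0 // ltW.
  rewrite enorm3_sqr => h.
  have : x 0 2%R <= Rs by have := sqr_ge0 (x 0 0); have := sqr_ge0 (x 0 1); nra.
  by move=> h2; rewrite distrC /T; have := ler_norm (Rs + 1 - x 0 2%R); lra.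
have far0 x : far T x -> u x = 0 /\ pr x = 0.
  by case=> h; apply: uout; [left|right]; exact: ltW.
have T0 : 0 <= T by rewrite /T; lra.
(* The density that the boundary law assigns to the gas pressure p_inf + 2 sigma / Rs. *)
pose rho := (p_inf + 2 * sigma / Rs) / (R_g * T_inf).
have rho0 : 0 < rho by rewrite divr_gt0 // addr_gt0 // divr_gt0 // mulr_gt0.
exists Rs; split=> //.
(* The torus flow solves the Euler equations of density 1, so its pressure is scaled by [rho_l] and
   shifted to p_inf at infinity. *)
exists u, (fun x => p_inf + rho_l * pr x), (fun=> rho), (fun=> 0), (p_inf + 2 * sigma / Rs).
have dp x : differentiable (fun x => p_inf + rho_l * pr x) x.
  apply: differentiableD; first exact: differentiable_cst.
  by apply: differentiableZ; case: (du x).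
split; first by move=> x _; split; [case: (du x)|exact: dp].
split.
  by apply: continuous_subspaceT => x; apply: differentiable_continuous; case: (du x).
split; first by apply: continuous_subspaceT => x; exact: differentiable_continuous.
split.
  move=> x _; split; [exact: differentiable_cst| |exact: differentiable_cst].
  by move=> i; rewrite dpart_const; exact: differentiable_cst.
split; first by apply: continuous_subspaceT; exact: cst_continuous.
split; first by apply: continuous_subspaceT; exact: cst_continuous.
split; first by [].
split.
  move=> x _; have [e1 e2] := ueq x; split=> //.
  rewrite grad3_affine; last by case: (du x).
  by rewrite scalerA mulVf ?scale1r // gt_eqF.
split.
  move=> x _; split.
    have -> : (fun y => rho *: (0 : 'rV[R]_3)) = (fun y : 'rV[R]_3 => 0).
      by apply/funext => y; rewrite scaler0.
    exact: div3_const.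
  by rewrite lap3_const grad3_const enorm3_0 dot30l expr0n mul0r !mulr0 !subr0.
split.
  move=> x xR; have [u0 p0] := in0 x ltac:(by rewrite xR); split.
  - by rewrite u0 dot30l.
  - by rewrite dot30l.
  - by rewrite p0 /surfdiv_normal_sphere; ring.
  - by rewrite /rho [RHS]mulrC divfK // gt_eqF.
split.
  exists 0, (T + 3) => x _ h; have [-> _] := far0 x (enorm3_far T x T0 h).
  by rewrite enorm3_0 mul0r.
split.
  move=> eps e0; exists (T + 3) => x _ h i.
  suff -> : dpart u i x = 0 by rewrite enorm3_0 ltW.
  have nf := near_far T x (enorm3_far T x T0 h).
  rewrite /dpart -(derive_cst (0 : 'rV[R]_3) x (e3 i)).
  apply: near_eq_derive.
  by apply: filterS nf => q /far0 [].
split.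
  move=> eps e0; exists (T + 3) => x _ h; have [_ ->] := far0 x (enorm3_far T x T0 h).
  by rewrite mulr0 addr0 subrr normr0 ltW.
split.
  (* The mass is the constant density times the volume of the ball, which is M by the choice of
     [Rs]. *)
  rewrite ball_setE // /leb3 integral_cst; last exact: measurable_ball_set.
  rewrite -[X in (_ * X)%E]/(volume Rs).
  by rewrite /rho mulrC EFinM -muleA RsE -EFinM mulKf // gt_eqF.
(* A point where the flow is nonzero lies outside the closed ball, since the flow vanishes on it. *)
exists x0; split=> //; rewrite /ext3 /= ltNge; apply/negP => /in0 [ux _].
by rewrite ux eqxx in ux0.
Qed.
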